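(* Let $1\le p\le\infty$, let $X$ and $Y$ be pointed metric spaces, and let $T:X\to Y$ be a Lipschitz operator. The following properties are equivalent: (1) $T:X\to Y$ is M-strictly Lipschitz $p$-summing. (2) The linearization operator $\widetilde T:\mathcal F(X)\to\mathcal F(Y)$ is $p$-summing. (3) The Lipschitz adjoint $T^{\#}:Y^{\#}\to X^{\#}$ is Cohen strongly $p^*$-summing, where $1/p+1/p^*=1$.
   Context: Banach spaces are real. A pointed metric space $X$ has a distinguished point $0$; Lipschitz operators $T:X\to Y$ are Lipschitz maps with $T(0)=0$. $X^{\#}$ is the Banach space of Lipschitz functions $f:X\to\mathbb R$ with $f(0)=0$, normed by the Lipschitz constant. For $x,y\in X$, $\delta_{(x,y)}\in (X^{\#})^*$ is $\delta_{(x,y)}(f)=f(x)-f(y)$; $\mathcal F(X)$ is the closed linear span of all $\delta_{(x,y)}$ in $(X^{\#})^*$, and $\mathcal F(X)^*=X^{\#}$ isometrically; $\delta_X:X\to\mathcal F(X)$, $\delta_X(x)=\delta_{(x,0)}$. $\widetilde T:\mathcal F(X)\to\mathcal F(Y)$ is the unique bounded linear operator with $\delta_Y\circ T=\widetilde T\circ\delta_X$. $T^{\#}(g)=g\circ T$ for $g\in Y^{\#}$. For a finite sequence in a Banach space $E$: $\|(e_i)\|_{l_p^n(E)}=(\sum_i\|e_i\|^p)^{1/p}$ and $\|(e_i)\|_{l_p^{n,w}(E)}=\sup_{e^*\in B_{E^*}}(\sum_i|\langle e_i,e^*\rangle|^p)^{1/p}$ (maxima when $p=\infty$). A linear operator $R:E\to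 F$ is $p$-summing if there is $C>0$ with $\|(R(x_i))\|_{l_p^n(F)}\le C\|(x_i)\|_{l_p^{n,w}(E)}$ for all finite sequences in $E$. It is Cohen strongly $p$-summing if there is $C>0$ with $\sum_{i=1}^n|\langle R(x_i),y_i^*\rangle|\le C\|(x_i)\|_{l_p^n(E)}\|(y_i^* )\|_{l_{p^*}^{n,w}(F^* )}$ for all $n$, $x_i\in E$, $y_i^*\in F^*$. For a Banach space $E$, $X\boxtimes E$ (Lipschitz tensor product) is the span of the functionals $\delta_{(x,y)}\boxtimes e: f\mapsto\langle f(x)-f(y),e\rangle$ on the space $Lip_0(X;E^* )$ of Lipschitz maps $X\to E^*$ vanishing at $0$. For $u=\sum_{k=1}^l\delta_{(x_k,y_k)}\boxtimes s_k\in X\boxtimes E$ put $d_p^L(u)=\inf\{\|(m_i)\|_{l_p^{n,w}(\mathcal F(X))}\|(e_i)\|_{l_{p^*}^n(E)}\}$, the infimum over all $n$ and all $m_i\in\mathcal F(X)$, $e_i\in E$ with $\sum_{i=1}^n m_i\otimes e_i=\sum_{k=1}^l\delta_{(x_k,y_k)}\otimes s_k$ in $\mathcal F(X)\otimes E$. $T:X\to Y$ is M-strictly Lipschitz $p$-summing if there is $C>0$ such that for all $l$, $x_k,y_k\in X$, $g_k\in Y^{\#}$ ($1\le k\le l$), $\big|\sum_{k=1}^l \big(g_k(T(x_k))-g_k(T(y_k))\big)\big|\le C\,d_p^L(u)$ with $u=\sum_{k=1}^l\delta_{(x_k,y_k)}\boxtimes g_k\in X\boxtimes Y^{\#}$.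 *)

(* Defs.v *)
From HB Require Import structures.
From mathcomp Require Import all_boot all_order all_algebra.
From mathcomp Require Import sesquilinear.
From mathcomp Require Import all_classical all_reals all_analysis.

Set Implicit Arguments.
Unset Strict Implicit.
Unset Printing Implicit Defensive.
Import Order.TTheory GRing.Theory Num.Def Num.Theory.
Import numFieldNormedType.Exports.
Local Open Scope classical_set_scope.
Local Open Scope ring_scope.

#[short(type="pmetricType")]
HB.structure Definition PointedMetric (R : numDomainType) :=
  {M of Metric R M & isPointed M}.

Section BoundedOperators.
Context {R : realType} (E F : normedModType R).

Definition bounded_op : {pred E -> F} := fun f =>
  `[< linear f /\ exists k : R, forall x, `|f x| <= k * `|x| >].

Record bop := Bop { bop_val :> E -> F; bopP : bop_val \in bounded_op }.
HB.instance Definition _ := [isSub for bop_val].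
HB.instance Definition _ := [Choice of bop by <:].

Lemma bounded_op_submod : submod_closed bounded_op.
Proof.
split.
  apply/asboolP; split; first by move=> a x y; rewrite scaler0 addr0.
  by exists 0 => x; rewrite normr0 mul0r.
move=> a f g /asboolP[fl [k fk]] /asboolP[gl [l gl']]; apply/asboolP; split.
  move=> b x y; rewrite !fctE /= fl gl !scalerDr !scalerA (mulrC a) !addrA.
  by congr (_ + _); rewrite -!addrA; congr (_ + _); rewrite addrC.
exists (`|a| * k + l) => x; rewrite !fctE /=.
apply: (le_trans (ler_normD _ _)); rewrite normrZ mulrDl -mulrA.
by apply: lerD; [exact: ler_wpM2l|].
Qed.
HB.instance Definition _ :=
  GRing.isSubmodClosed.Build R (E -> F) bounded_op bounded_op_submod.
HB.instance Definition _ := [SubChoice_isSubLmodule of bop by <:].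

Lemma bop_linear (f : bop) : linear f.
Proof. by have /asboolP[] := bopP f. Qed.
HB.instance Definition _ (f : bop) :=
  GRing.isLinear.Build R E F _ f (@bop_linear f).

Lemma bop_ext (f g : bop) : f =1 g -> f = g.
Proof. by move=> /funext fg; exact: val_inj. Qed.

Definition op_norm (f : bop) : R := sup [set `|f x| | x in [set x | `|x| <= 1]].

Lemma op_norm_has_sup (f : bop) : has_sup [set `|f x| | x in [set x | `|x| <= 1]].
Proof.
split; first by exists `|f 0|, 0 => //=; rewrite normr0.
have /asboolP[_ [k fk]] := bopP f.
exists `|k| => _ [x /= x1 <-]; apply: (le_trans (fk x)).
apply: (le_trans (ler_wpM2r _ (ler_norm k))) => //.
exact: ler_piMr.
Qed.

Lemma op_norm_ge (f : bop) x : `|x| <= 1 -> `|f x| <= op_norm f.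
Proof.
by move=> x1; apply: ub_le_sup; [case: (op_norm_has_sup f)|exists x].
Qed.

Lemma op_norm_ge0 f : 0 <= op_norm f.
Proof. by apply: (le_trans (normr_ge0 (f 0))); apply: op_norm_ge; rewrite normr0. Qed.

Lemma op_norm_le (f : bop) k :
  (forall x, `|x| <= 1 -> `|f x| <= k) -> op_norm f <= k.
Proof.
move=> fk; apply: ge_sup; first by case: (op_norm_has_sup f).
by move=> _ [x /= x1 <-]; exact: fk.
Qed.

Lemma op_normP (f : bop) x : `|f x| <= op_norm f * `|x|.
Proof.
have [->|x0] := eqVneq x 0; first by rewrite linear0 !normr0 mulr0.
rewrite -ler_pdivrMr ?normr_gt0// mulrC -{1}(@ger0_norm _ (`|x|^-1)) ?invr_ge0//.
by rewrite -normrZ -linearZ; apply: op_norm_ge; rewrite normfZV.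
Qed.

Lemma bopDE (f g : bop) x : (f + g) x = f x + g x. Proof. by []. Qed.
Lemma bopZE a (f : bop) x : (a *: f) x = a *: f x. Proof. by []. Qed.

Lemma op_normD f g : op_norm (f + g) <= op_norm f + op_norm g.
Proof.
apply: op_norm_le => x x1; rewrite bopDE.
by apply: (le_trans (ler_normD _ _)); apply: lerD; exact: op_norm_ge.
Qed.

Lemma op_normZ a f : op_norm (a *: f) = `|a| * op_norm f.
Proof.
have le b (g : bop) : op_norm (b *: g) <= `|b| * op_norm g.
  apply: op_norm_le => x x1; rewrite bopZE normrZ.
  by apply: ler_wpM2l => //; exact: op_norm_ge.
apply/eqP; rewrite eq_le le /=.
have [->|a0] := eqVneq a 0; first by rewrite normr0 mul0r op_norm_ge0.
rewrite -ler_pdivlMl ?normr_gt0// -normfV.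
by rewrite {1}(_ : f = a^-1 *: (a *: f)) ?le// scalerA mulVf// scale1r.
Qed.

Lemma op_norm0_eq0 f : op_norm f = 0 -> f = 0.
Proof.
move=> f0; apply: bop_ext => x; apply/normr0_eq0/eqP.
by rewrite eq_le normr_ge0 andbT -(mul0r `|x|) -f0 op_normP.
Qed.

HB.instance Definition _ :=
  Lmodule_isNormed.Build R bop op_normD op_normZ op_norm0_eq0.

End BoundedOperators.

Definition dual {R : realType} (E : normedModType R) := bop E R^o.

Section LipschitzFunctions.
Context {R : realType} (X : pmetricType R) (E : normedModType R).

Definition is_lip0 : {pred X -> E} := fun f =>
  `[< f point = 0 /\ exists k : R, forall x y, `|f x - f y| <= k * mdist x y >].

(* Lip_0(X; E); in particular X^# is [lip0 X R^o]. *)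
Record lip0 := Lip0 { lip0_val :> X -> E; lip0P : lip0_val \in is_lip0 }.
HB.instance Definition _ := [isSub for lip0_val].
HB.instance Definition _ := [Choice of lip0 by <:].

Lemma is_lip0_submod : submod_closed is_lip0.
Proof.
split.
  apply/asboolP; split => //.
  by exists 0 => x y; rewrite subrr normr0 mul0r.
move=> a f g /asboolP[f0 [k fk]] /asboolP[g0 [l gl]]; apply/asboolP; split.
  by rewrite !fctE /= f0 g0 scaler0 addr0.
exists (`|a| * k + l) => x y; rewrite !fctE /=.
rewrite opprD addrACA -scalerBr.
apply: (le_trans (ler_normD _ _)); rewrite normrZ mulrDl -mulrA.
by apply: lerD; [exact: ler_wpM2l|].
Qed.
HB.instance Definition _ :=
  GRing.isSubmodClosed.Build R (X -> E) is_lip0 is_lip0_submod.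
HB.instance Definition _ := [SubChoice_isSubLmodule of lip0 by <:].

Lemma lip0_ext (f g : lip0) : f =1 g -> f = g.
Proof. by move=> /funext fg; exact: val_inj. Qed.

Lemma lip0_point (f : lip0) : f point = 0.
Proof. by have /asboolP[] := lip0P f. Qed.

(* The pairs with x = y contribute 0 / 0 = 0. *)
Definition lip_const (f : lip0) : R :=
  sup [set `|f z.1 - f z.2| / mdist z.1 z.2 | z in [set: X * X]].

Lemma lip_const_has_sup (f : lip0) :
  has_sup [set `|f z.1 - f z.2| / mdist z.1 z.2 | z in [set: X * X]].
Proof.
split; first by exists (`|f (@point X) - f point| / mdist (@point X) point), (point, point).
have /asboolP[_ [k fk]] := lip0P f.
exists `|k| => _ [[x y] _ <-] /=.
have [->|xy] := eqVneq x y; first by rewrite subrr normr0 mul0r.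
rewrite ler_pdivrMr ?mdist_gt0//; apply: (le_trans (fk x y)).
by rewrite ler_wpM2r ?mdist_ge0 ?ler_norm.
Qed.

Lemma lip_constP (f : lip0) x y : `|f x - f y| <= lip_const f * mdist x y.
Proof.
have [->|xy] := eqVneq x y; first by rewrite subrr normr0 mdistxx mulr0.
rewrite -ler_pdivrMr ?mdist_gt0//; apply: ub_le_sup.
  by case: (lip_const_has_sup f).
by exists (x, y).
Qed.

Lemma lip_const_ge0 f : 0 <= lip_const f.
Proof.
apply: ub_le_sup; first by case: (lip_const_has_sup f).
by exists (point, point) => //=; rewrite subrr normr0 mul0r.
Qed.

Lemma lip_const_le (f : lip0) k : 0 <= k ->
  (forall x y, `|f x - f y| <= k * mdist x y) -> lip_const f <= k.
Proof.
move=> k0 fk; apply: ge_sup; first by case: (lip_const_has_sup f).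
move=> _ [[x y] _ <-] /=.
have [->|xy] := eqVneq x y; first by rewrite subrr normr0 mul0r.
by rewrite ler_pdivrMr ?mdist_gt0.
Qed.

Lemma lip0DE (f g : lip0) x : (f + g) x = f x + g x. Proof. by []. Qed.
Lemma lip0ZE a (f : lip0) x : (a *: f) x = a *: f x. Proof. by []. Qed.

Lemma lip_constD f g : lip_const (f + g) <= lip_const f + lip_const g.
Proof.
apply: lip_const_le => [|x y]; first by rewrite addr_ge0 ?lip_const_ge0.
rewrite !lip0DE opprD addrACA mulrDl.
by apply: (le_trans (ler_normD _ _)); apply: lerD; exact: lip_constP.
Qed.

Lemma lip_constZ a f : lip_const (a *: f) = `|a| * lip_const f.
Proof.
have le b (g : lip0) : lip_const (b *: g) <= `|b| * lip_const g.
  apply: lip_const_le => [|x y]; first by rewrite mulr_ge0 ?lip_const_ge0.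
  rewrite !lip0ZE -scalerBr normrZ -mulrA.
  by apply: ler_wpM2l => //; exact: lip_constP.
apply/eqP; rewrite eq_le le /=.
have [->|a0] := eqVneq a 0; first by rewrite normr0 mul0r lip_const_ge0.
rewrite -ler_pdivlMl ?normr_gt0// -normfV.
by rewrite {1}(_ : f = a^-1 *: (a *: f)) ?le// scalerA mulVf// scale1r.
Qed.

Lemma lip_const0_eq0 f : lip_const f = 0 -> f = 0.
Proof.
move=> f0; apply: lip0_ext => x; apply/normr0_eq0/eqP.
rewrite eq_le normr_ge0 andbT -[f x]subr0 -(lip0_point f).
by rewrite -(mul0r (mdist x point)) -f0 lip_constP.
Qed.

HB.instance Definition _ :=
  Lmodule_isNormed.Build R lip0 lip_constD lip_constZ lip_const0_eq0.

End LipschitzFunctions.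

Section ClosedLinearSpan.
Context {R : realType} {V : normedModType R}.

Definition linear_span (S : set V) : set V := [set v |
  exists (n : nat) (a : 'I_n -> R) (s : 'I_n -> V),
    (forall i, S (s i)) /\ v = \sum_i a i *: s i].

Lemma linear_span_comb (S : set V) a u v :
  linear_span S u -> linear_span S v -> linear_span S (a *: u + v).
Proof.
move=> [n [b [s [Ss ->]]]] [m [c [t [St ->]]]].
exists (n + m)%N, (fun i => match fintype.split i with inl j => a * b j | inr j => c j end),
  (fun i => match fintype.split i with inl j => s j | inr j => t j end); split.
  by move=> i; case: fintype.split.
rewrite big_split_ord /= scaler_sumr; congr (_ + _); apply: eq_bigr => i _.
  by rewrite (unsplitK (inl i)) scalerA.
by rewrite (unsplitK (inr i)).
Qed.

Lemma closure_normP (A : set V) x :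
  closure A x <-> forall e : R, 0 < e -> exists2 y, A y & `|x - y| < e.
Proof.
split=> [cA e e0|H B /nbhs_normP[e /= e0 eB]].
  have [|y [Ay xy]] := cA (ball x e); first exact: nbhsx_ballx.
  by exists y => //; move: xy; rewrite -ball_normE.
by have [y Ay xy] := H e e0; exists y; split => //; exact: eB.
Qed.

Lemma closure_span_submod (S : set V) :
  submod_closed (fun v => `[< closure (linear_span S) v >]).
Proof.
split.
  apply/asboolP/subset_closure; exists 0%N, (fun=> 0), (fun=> 0).
  by split => [[]//|]; rewrite big_ord0.
move=> a u v /asboolP/closure_normP cu /asboolP/closure_normP cv.
apply/asboolP/closure_normP => e e0.
have [u' Su' uu'] := cu (e / 2 / (`|a| + 1)) ltac:(by rewrite !divr_gt0 // ltr_wpDl).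
have [v' Sv' vv'] := cv (e / 2) ltac:(by rewrite divr_gt0).
exists (a *: u' + v'); first exact: linear_span_comb.
rewrite opprD addrACA -scalerBr (splitr e).
apply: (le_lt_trans (ler_normD _ _)); apply: ler_ltD => //.
rewrite normrZ; apply: (le_trans (ler_wpM2l (normr_ge0 a) (ltW uu'))).
rewrite mulrCA ler_piMr ?divr_ge0 ?ltW// ltr_pdivrMr ?ltr_wpDl//.
by rewrite mul1r ltrDl.
Qed.

End ClosedLinearSpan.

Section FreeSpace.
Context {R : realType} (X : pmetricType R).

Definition eval_diff_fun (x y : X) : lip0 X R^o -> R^o := fun f => f x - f y.

Lemma eval_diff_bounded x y : eval_diff_fun x y \in @bounded_op R (lip0 X R^o) R^o.
Proof.
apply/asboolP; split.
  by move=> a f g; rewrite /eval_diff_fun !lip0DE !lip0ZE opprD addrACA scalerBr.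
exists (mdist x y) => f; rewrite mulrC; exact: lip_constP.
Qed.

Definition eval_diff (x y : X) : dual (lip0 X R^o) := Bop (eval_diff_bounded x y).

Definition in_free : {pred dual (lip0 X R^o)} := fun m =>
  `[< closure (linear_span [set eval_diff z.1 z.2 | z in [set: X * X]]) m >].

(* The Lipschitz-free space F(X), with the norm of (X^#)^*. *)
Record free := Free { free_val :> dual (lip0 X R^o); freeP : free_val \in in_free }.
HB.instance Definition _ := [isSub for free_val].
HB.instance Definition _ := [Choice of free by <:].
HB.instance Definition _ := GRing.isSubmodClosed.Build R (dual (lip0 X R^o)) in_free
  (@closure_span_submod R (dual (lip0 X R^o)) _).
HB.instance Definition _ := [SubChoice_isSubLmodule of free by <:].

Definition free_norm (m : free) : R := `|free_val m|.

Lemma free_normD m n : free_norm (m + n) <= free_norm m + free_norm n.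
Proof. exact: ler_normD. Qed.
Lemma free_normZ a m : free_norm (a *: m) = `|a| * free_norm m.
Proof. exact: normrZ. Qed.
Lemma free_norm0_eq0 m : free_norm m = 0 -> m = 0.
Proof. by move=> /normr0_eq0 m0; exact: val_inj. Qed.
HB.instance Definition _ :=
  Lmodule_isNormed.Build R free free_normD free_normZ free_norm0_eq0.

Lemma eval_diff_in_free x y : eval_diff x y \in in_free.
Proof.
apply/asboolP/subset_closure; exists 1%N, (fun=> 1), (fun=> eval_diff x y).
by split => [i|]; [exists (x, y)|rewrite big_ord1 scale1r].
Qed.

Definition delta (x y : X) : free := Free (eval_diff_in_free x y).

Definition delta_pt (x : X) : free := delta x point.

End FreeSpace.

Lemma delta_ptB {R : realType} (X : pmetricType R) (x y : X) :
  delta x y = delta_pt x - delta_pt y.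
Proof.
apply: val_inj; apply: bop_ext => f /=.
change (f x - f y = (f x - f point) - (f y - f point)).
by rewrite opprB addrA subrK.
Qed.

Section Adjoint.
Context {R : realType} {E F : normedModType R} (S : bop E F).

Lemma bop_comp_bounded (phi : dual F) : phi \o S \in @bounded_op R E R^o.
Proof.
apply/asboolP; split; first by move=> a x y; rewrite /= !linearP.
exists (op_norm phi * op_norm S) => x; apply: (le_trans (op_normP _ _)).
by rewrite -mulrA ler_wpM2l ?op_norm_ge0 ?op_normP.
Qed.

Definition adjoint_fun (phi : dual F) : dual E := Bop (bop_comp_bounded phi).

Lemma adjoint_bounded : adjoint_fun \in @bounded_op R (dual F) (dual E).
Proof.
apply/asboolP; split; first by move=> a phi psi; exact: bop_ext.
exists (op_norm S) => phi; apply: op_norm_le => x x1.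
apply: (le_trans (op_normP phi (S x))); rewrite mulrC ler_wpM2r ?op_norm_ge0//.
exact: op_norm_ge.
Qed.

Definition adjoint : bop (dual F) (dual E) := Bop adjoint_bounded.

End Adjoint.

Record lipop {R : realType} (X Y : pmetricType R) := LipOp {
  lipop_fun :> X -> Y;
  lipop_point : lipop_fun point = point;
  lipop_lip : exists k : R, forall x y,
    mdist (lipop_fun x) (lipop_fun y) <= k * mdist x y }.

Section Linearization.
Context {R : realType} {X Y : pmetricType R} (T : lipop X Y).

Lemma lipop_lip_ge0 : exists2 k : R, 0 <= k &
  forall x y, mdist (T x) (T y) <= k * mdist x y.
Proof.
have [k Tk] := lipop_lip T; exists `|k| => // x y.
by apply: (le_trans (Tk x y)); rewrite ler_wpM2r ?mdist_ge0 ?ler_norm.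
Qed.

Lemma comp_is_lip0 (g : lip0 Y R^o) : g \o T \in @is_lip0 R X R^o.
Proof.
have [k k0 Tk] := lipop_lip_ge0.
apply/asboolP; split; first by rewrite /= lipop_point lip0_point.
exists (lip_const g * k) => x y /=; apply: (le_trans (lip_constP g _ _)).
by rewrite -mulrA ler_wpM2l ?lip_const_ge0.
Qed.

Definition lip_adj_fun (g : lip0 Y R^o) : lip0 X R^o := Lip0 (comp_is_lip0 g).

Lemma lip_adj_bounded : lip_adj_fun \in @bounded_op R (lip0 Y R^o) (lip0 X R^o).
Proof.
have [k k0 Tk] := lipop_lip_ge0.
apply/asboolP; split; first by move=> a f g; exact: lip0_ext.
exists k => g; apply: lip_const_le => [|x y]; first by rewrite mulr_ge0.
apply: (le_trans (lip_constP g (T x) (T y))).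
by rewrite mulrC mulrAC ler_wpM2r ?lip_const_ge0.
Qed.

Definition lip_adj : bop (lip0 Y R^o) (lip0 X R^o) := Bop lip_adj_bounded.

Lemma adjoint_lip_adj_eval x y :
  adjoint lip_adj (eval_diff x y) = eval_diff (T x) (T y).
Proof. exact: bop_ext. Qed.

Lemma adjoint_in_free (m : free X) : adjoint lip_adj (free_val m) \in @in_free R Y.
Proof.
have /asboolP/closure_normP cm := freeP m.
apply/asboolP/closure_normP => e e0.
have l1 : 0 < op_norm (adjoint lip_adj) + 1 by rewrite ltr_wpDl ?op_norm_ge0.
have [_ [n [a [s [Ss ->]]]] mn] := cm _ (divr_gt0 e0 l1).
exists (adjoint lip_adj (\sum_i a i *: s i)).
  exists n, a, (fun i => adjoint lip_adj (s i)); split => [i|].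
    have [[x y] _ <-] := Ss i.
    by exists (T x, T y) => //; rewrite adjoint_lip_adj_eval.
  by rewrite linear_sum; apply: eq_bigr => i _; rewrite linearZ.
rewrite -linearB; apply: (le_lt_trans (op_normP _ _)).
move: mn; rewrite ltr_pdivlMr// mulrC; apply: le_lt_trans.
by rewrite ler_wpM2r ?normr_ge0// lerDl.
Qed.

Definition linearization_fun (m : free X) : free Y := Free (adjoint_in_free m).

Lemma linearization_bounded :
  linearization_fun \in @bounded_op R (free X) (free Y).
Proof.
apply/asboolP; split; first by move=> a m n; apply: val_inj; exact: linearP.
by exists (op_norm (adjoint lip_adj)) => m; exact: op_normP.
Qed.

(* The restriction of (T^#)^* to F(X); [linearizationP] is the property that
   characterizes it. *)
Definition linearization : bop (free X) (free Y) := Bop linearization_bounded.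

Lemma linearization_delta x y : linearization (delta x y) = delta (T x) (T y).
Proof. by apply: val_inj; exact: adjoint_lip_adj_eval. Qed.

Lemma linearizationP (S : bop (free X) (free Y)) :
  (@delta_pt R Y) \o T = S \o (@delta_pt R X) <-> S = linearization.
Proof.
split=> [ST|->]; last first.
  by apply/funext => x; rewrite [RHS](linearization_delta x point) lipop_point.
have Sd x y : S (delta x y) = linearization (delta x y).
  have Spt z : S (delta_pt z) = delta_pt (T z) by rewrite -[RHS]/((_ \o T) z) ST.
  by rewrite linearization_delta (delta_ptB (T x)) -!Spt -raddfB -delta_ptB.
apply: bop_ext => m; apply/eqP; rewrite -subr_eq0 -normr_eq0; apply/eqP.
set D := S - linearization.
have -> : S m - linearization m = D m by [].
apply/eqP; rewrite eq_le normr_ge0 andbT; apply/ler_addgt0Pl => e e0; rewrite addr0.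
have d1 : 0 < op_norm D + 1 by rewrite ltr_wpDl ?op_norm_ge0.
have /asboolP/closure_normP cm := freeP m.
have [_ [n [a [s [Ss ->]]]] mn] := cm _ (divr_gt0 e0 d1).
have /choice[z zs] : forall i, exists z : X * X, eval_diff z.1 z.2 = s i.
  by move=> i; have [z _ zi] := Ss i; exists z.
pose m' : free X := \sum_i a i *: delta (z i).1 (z i).2.
have m'E : free_val m' = \sum_i a i *: s i.
  rewrite -[LHS]/(val m') /m' raddf_sum.
  by apply: eq_bigr => i _; rewrite -zs.
have Dm' : D m' = 0.
  have Dz i : D (delta (z i).1 (z i).2) = 0 
    by exact: eq_trans (congr1 (fun w => w - linearization _) (Sd _ _)) (subrr _).
  rewrite /m' linear_sum big1// => i _.
  have DZ : D (a i *: delta (z i).1 (z i).2) = a i *: D (delta (z i).1 (z i).2).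
    exact: linearZ.
  by apply: (etrans DZ); rewrite Dz scaler0.
rewrite -[D m]subr0 -Dm' -linearB; apply: (le_trans (op_normP _ _)).
have : `|m - m'| < e / (op_norm D + 1).
  by rewrite -[`|m - m'|]/(`|free_val m - free_val m'|) m'E.
rewrite ltr_pdivlMr// mulrC => /ltW; apply: le_trans.
by rewrite ler_wpM2r ?normr_ge0// lerDl.
Qed.

End Linearization.

Section Summing.
Context {R : realType}.

(* Only used for 1 <= p, so the value at -oo is irrelevant. *)
Definition lp_norm (p : \bar R) (n : nat) (a : 'I_n -> R) : R :=
  match p with
  | r%:E => (\sum_i `|a i| `^ r) `^ r^-1
  | +oo%E => \big[maxr/0]_i `|a i|
  | -oo%E => 0
  end.

Definition strong_lp (E : normedModType R) (p : \bar R) (n : nat) (e : 'I_n -> E) : R :=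
  lp_norm p (fun i => `|e i|).

Definition weak_lp (E : normedModType R) (p : \bar R) (n : nat) (e : 'I_n -> E) : R :=
  sup [set lp_norm p (fun i => phi (e i) : R) | phi in [set phi : dual E | `|phi| <= 1]].

Definition p_summing (E F : normedModType R) (p : \bar R) (S : {linear E -> F}) :=
  exists2 C : R, 0 < C & forall (n : nat) (x : 'I_n -> E),
    strong_lp p (fun i => S (x i)) <= C * weak_lp p x.

Definition cohen_strongly_summing (E F : normedModType R) (p : \bar R)
    (S : {linear E -> F}) :=
  exists2 C : R, 0 < C & forall (n : nat) (x : 'I_n -> E) (y : 'I_n -> dual F),
    \sum_i `|y i (S (x i))| <= C * (strong_lp p x * weak_lp (hoelder_conjugate p) y).

End Summing.

(* The tensor product U (x) V of two vector spaces is realized, as in Ryan's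
   "Introduction to Tensor Products of Banach Spaces", as a space of functionals
   on the bilinear forms on U x V. *)
Definition tensor {R : realType} {U V : lmodType R} (u : U) (v : V) :
  {bilinear U -> V -> R^o} -> R^o := fun B => B u v.

Section LipschitzTensor.
Context {R : realType} {X : pmetricType R} {E : normedModType R}.

Definition lip_tensor (x y : X) (e : E) : lip0 X (dual E) -> R^o :=
  fun f => (f x - f y) e.

(* [dL p u] is meant for u in the span of the [lip_tensor x y e]; by
   [dL_sum] below, the choice of the representation of u does not matter. *)
Definition dL (p : \bar R) (u : lip0 X (dual E) -> R^o) : R :=
  inf [set r | exists (l : nat) (x y : 'I_l -> X) (s : 'I_l -> E)
                      (n : nat) (m : 'I_n -> free X) (e : 'I_n -> E),
    [/\ u = \sum_k lip_tensor (x k) (y k) (s k),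
        \sum_i tensor (m i) (e i) = \sum_k tensor (delta (x k) (y k)) (s k) &
        r = weak_lp p m * strong_lp (hoelder_conjugate p) e]].

Lemma tensor_eq0 (l : nat) (M : 'I_l -> free X) (s : 'I_l -> E)
    (B : {bilinear free X -> E -> R^o}) :
  (forall f : lip0 X R^o, \sum_k free_val (M k) f *: s k = 0) ->
  \sum_k B (M k) (s k) = 0.
Proof.
elim: l M s => [|l IH] M s H; first by rewrite big_ord0.
have [M0|/existsNP[f0 /eqP Mf0]] := pselect (forall f, free_val (M ord_max) f = 0).
  have Mm0 : M ord_max = 0 by apply: val_inj; apply: bop_ext => f; exact: M0.
  rewrite big_ord_recr /= IH ?add0r ?Mm0 ?linear0l// => f.
  by have := H f; rewrite big_ord_recr /= M0 scale0r addr0.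
pose w := widen_ord (leqnSn l).
pose c (k : 'I_l) : R := free_val (M (w k)) f0 / free_val (M ord_max) f0.
have sE : s ord_max = - \sum_k c k *: s (w k).
  have /eqP := H f0; rewrite big_ord_recr /= addr_eq0 => /eqP H0.
  apply: (scalerI Mf0); rewrite scalerN scaler_sumr -[LHS]opprK -H0; congr (- _).
  by apply: eq_bigr => k _; rewrite scalerA mulrC divfK.
rewrite big_ord_recr /=.
have <- : \sum_k B (M (w k) - c k *: M ord_max) (s (w k)) =
    \sum_k B (M (w k)) (s (w k)) + B (M ord_max) (s ord_max).
  rewrite sE linearNr linear_sumr /= -sumrB; apply: eq_bigr => k _.
  by rewrite linearBl linearZl_LR linearZr_LR.
apply: IH => f.
rewrite -[RHS](H f) big_ord_recr /= sE scalerN scaler_sumr -sumrB.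
apply: eq_bigr => k _; rewrite scalerA -scalerBl; congr (_ *: _).
by rewrite mulrC.
Qed.

Lemma scale_is_lip0 (f : lip0 X R^o) (phi : dual E) :
  (fun x => f x *: phi) \in @is_lip0 R X (dual E).
Proof.
apply/asboolP; split; first by rewrite lip0_point scale0r.
exists (lip_const f * `|phi|) => x y; rewrite -scalerBl normrZ mulrAC.
by rewrite ler_wpM2r ?lip_constP.
Qed.

Lemma lip_tensor_eq (sep : forall v : E, (forall phi : dual E, phi v = 0) -> v = 0)
    (l l' : nat) (x y : 'I_l -> X) (s : 'I_l -> E)
    (x' y' : 'I_l' -> X) (s' : 'I_l' -> E) :
  \sum_k lip_tensor (x k) (y k) (s k) = \sum_k lip_tensor (x' k) (y' k) (s' k) ->
  \sum_k tensor (delta (x k) (y k)) (s k) =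
    \sum_k tensor (delta (x' k) (y' k)) (s' k).
Proof.
move=> ss'; apply/funext => B; rewrite !fct_sumE /tensor.
apply/eqP; rewrite -subr_eq0; apply/eqP.
pose M (k : 'I_(l + l')) : free X := match fintype.split k with
  | inl i => delta (x i) (y i) | inr j => - delta (x' j) (y' j) end.
pose t (k : 'I_(l + l')) : E := match fintype.split k with
  | inl i => s i | inr j => s' j end.
have -> : \sum_k B (delta (x k) (y k)) (s k) -
    \sum_k B (delta (x' k) (y' k)) (s' k) = \sum_k B (M k) (t k).
  rewrite big_split_ord /= -sumrN; congr (_ + _); apply: eq_bigr => i _.
    by rewrite /M /t (unsplitK (inl i)).
  by rewrite /M /t (unsplitK (inr i)) linearNl.
apply: tensor_eq0 => f; apply: sep => phi.
have := congr1 (fun u => u (Lip0 (scale_is_lip0 f phi))) ss'.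
rewrite !fct_sumE /lip_tensor /= => /eqP; rewrite -subr_eq0 => /eqP fphi.
rewrite linear_sum /= -[RHS]fphi big_split_ord /= -sumrN; congr (_ + _).
  apply: eq_bigr => i _; rewrite /M /t (unsplitK (inl i)) linearZ /=.
  by rewrite -scalerBl.
apply: eq_bigr => i _; rewrite /M /t (unsplitK (inr i)) linearZ /=.
by rewrite -scalerBl -scaleNr.
Qed.

Lemma dL_sum (sep : forall v : E, (forall phi : dual E, phi v = 0) -> v = 0)
    (p : \bar R) (l : nat) (x y : 'I_l -> X) (s : 'I_l -> E) :
  dL p (\sum_k lip_tensor (x k) (y k) (s k)) =
  inf [set r | exists (n : nat) (m : 'I_n -> free X) (e : 'I_n -> E),
    \sum_i tensor (m i) (e i) = \sum_k tensor (delta (x k) (y k)) (s k) /\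
    r = weak_lp p m * strong_lp (hoelder_conjugate p) e].
Proof.
congr inf; apply/seteqP; split=> r /=.
  move=> [l' [x' [y' [s' [n [m [e [us me ->]]]]]]]]; exists n, m, e; split => //.
  by rewrite me; apply/esym/lip_tensor_eq.
by move=> [n [m [e [me ->]]]]; exists l, x, y, s, n, m, e.
Qed.

End LipschitzTensor.

(* The hypothesis of [dL_sum] holds for E = Y^#. *)
Lemma dual_lip0_sep {R : realType} (Y : pmetricType R) (g : lip0 Y R^o) :
  (forall phi : dual (lip0 Y R^o), phi g = 0) -> g = 0.
Proof.
move=> g0; apply: lip0_ext => y; have := g0 (eval_diff y point).
by rewrite /= /eval_diff_fun lip0_point subr0.
Qed.

Definition M_strictly_lip_summing {R : realType} {X Y : pmetricType R}
    (p : \bar R) (T : lipop X Y) :=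
  exists2 C : R, 0 < C &
    forall (l : nat) (x y : 'I_l -> X) (g : 'I_l -> lip0 Y R^o),
      `|\sum_k (g k (T (x k)) - g k (T (y k)))|
        <= C * dL p (\sum_k lip_tensor (x k) (y k) (g k)).

(* Main.v *)
From HB Require Import structures.
From mathcomp Require Import all_boot all_order all_algebra.
From mathcomp Require Import sesquilinear.
From mathcomp Require Import all_classical all_reals all_analysis.
From mathcomp Require Import ring lra.
Require Import Defs.

(**
(1) and (2) compare through the bilinear form (m, g) |-> <T~ m, g>: by duality
the p-sum of the norms |T~ m_i| is the supremum of sum_i <T~ m_i, g_i> over the
g in Y^# with |g|_q <= 1, and (1) bounds such sums when the m_i are finite
combinations of the delta_(x,y), which are dense in F(X).

(3) => (2) is the case of y_i in F(X), embedded in (X^#)^*.  In (2) => (3) the y_i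
live in the bidual F(X)^** = (X^#)^*, and a local reflexivity argument is
needed.  The functional m |-> sum_i <T~ m_i, g_i> on F(X)^n is bounded for the
weak l_p norm.  With a finite net (b_k) of the l_q^n ball, that norm is at most
2 max_k |sum_i b_k(i) m_i|, so Hahn-Banach in a finite max-norm power of F(X)
gives T^# g_i = sum_k b_k(i) h_k with h_k in X^# and sum_k |h_k| controlled.
Any y_i in (X^#)^* can be evaluated on this finite formula.
*)

Set Implicit Arguments.
Unset Strict Implicit.
Unset Printing Implicit Defensive.
Import Order.TTheory GRing.Theory Num.Def Num.Theory.
Import numFieldNormedType.Exports.
Local Open Scope classical_set_scope.
Local Open Scope ring_scope.

(** * Hoelder inequality and duality for [lp_norm] on finite sequences *)

Section LpNorm.
Context {R : realType}.
Implicit Types (p : \bar R) (n : nat).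

Lemma hoelder_conjugate_cases p : (1 <= p)%E ->
  [\/ p = 1%E /\ hoelder_conjugate p = +oo%E,
      p = +oo%E /\ hoelder_conjugate p = 1%E |
      exists r s : R, [/\ p = r%:E, hoelder_conjugate p = s%:E, 1 < r, 1 < s & r^-1 + s^-1 = 1]].
Proof.
case: p => [r||//]; last by move=> _; apply: Or32.
rewrite lee_fin le_eqVlt => /predU1P[<-|r1].
  by apply: Or31; rewrite hoelder_conjugate1.
apply: Or33; exists r, (r / (r - 1)).
have rB1 : 0 < r - 1 by lra.
have r0 : 0 < r by lra.
split => //.
- rewrite /hoelder_conjugate/= eqe gt_eqF// inver gt_eqF//.
- by rewrite ltr_pdivlMr//; lra.
- by field; rewrite !gt_eqF.
Qed.

Lemma lp_norm_ge0 p n (a : 'I_n -> R) : 0 <= lp_norm p a.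
Proof.
by case: p => [r||]//=; [exact: powR_ge0|exact: bigmax_ge_id].
Qed.

Let le_powR r (x y : R) : 0 <= r -> 0 <= x -> x <= y -> x `^ r <= y `^ r.
Proof.
by move=> r0 x0 xy; apply: ge0_ler_powR; rewrite ?nnegrE//; exact: le_trans xy.
Qed.

Let sum_powR_ge0 n (a : 'I_n -> R) r : 0 <= \sum_i `|a i| `^ r.
Proof. by apply: sumr_ge0 => i _; exact: powR_ge0. Qed.

Let sum_powR_normalized n (a : 'I_n -> R) r A : 0 < A ->
  \sum_i `|a i| `^ r = A `^ r -> \sum_i (`|a i| / A) `^ r = 1.
Proof.
move=> A0 aA; have Ai : 0 <= A^-1 by rewrite invr_ge0 ltW.
under eq_bigr do rewrite powRM//.
by rewrite -mulr_suml aA -powRM// ?ltW// mulfV ?gt_eqF// powR1.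
Qed.

Lemma coord_le_lp_norm p n (a : 'I_n -> R) i : (1 <= p)%E -> `|a i| <= lp_norm p a.
Proof.
case: p => [r||//]; last by move=> _; exact: (le_bigmax _ (fun i => `|a i|)).
rewrite lee_fin => r1; have r0 : 0 < r by lra.
rewrite -[leLHS]powRr1// -(mulfV (lt0r_neq0 r0)) powRrM.
apply: le_powR; [by rewrite invr_ge0 ltW|exact: powR_ge0|].
by rewrite (bigD1 i)//= lerDl sumr_ge0// => *; exact: powR_ge0.
Qed.

Lemma lp_norm_hoelder p n (a b : 'I_n -> R) : (1 <= p)%E ->
  \sum_i `|a i * b i| <= lp_norm p a * lp_norm (hoelder_conjugate p) b.
Proof.
move=> p1.
have aux c d : \sum_i `|c i * d i| <= lp_norm 1 c * @lp_norm R +oo n d.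
  rewrite /= invr1 powRr1; last exact: sum_powR_ge0.
  rewrite mulr_suml; apply: ler_sum => i _; rewrite normrM powRr1// ler_wpM2l//.
  exact: (le_bigmax _ (fun i => `|d i|)).
have [[-> ->]|[-> ->]|] := hoelder_conjugate_cases p1; first exact: aux.
  rewrite mulrC; apply: le_trans (aux b a); apply: ler_sum => i _.
  by rewrite mulrC.
move=> [r [s [pr qs r1 s1 rs]]].
have [r0 s0] : 0 < r /\ 0 < s by split; lra.
have hp (c : 'I_n -> R) (t : R) i : 1 < t -> lp_norm t%:E c = 0 -> c i = 0 :> R.
  move=> t1 c0; apply/eqP; rewrite -normr_le0 -c0.
  by apply: coord_le_lp_norm; rewrite lee_fin ltW.
have eqv t (c : 'I_n -> R) : 0 < t -> \sum_i `|c i| `^ t = lp_norm t%:E c `^ t.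
  by move=> t0 /=; rewrite -powRrM mulVf ?gt_eqF// powRr1// sum_powR_ge0.
rewrite qs pr.
set A := lp_norm r%:E a; set B := lp_norm s%:E b.
have [A0|A0] := eqVneq A 0.
  by rewrite big1 ?A0 ?mul0r// => i _; rewrite (hp a r i) ?mul0r ?normr0.
have [B0|B0] := eqVneq B 0.
  by rewrite big1 ?B0 ?mulr0// => i _; rewrite (hp b s i) ?mulr0 ?normr0.
have {}A0 : 0 < A by rewrite lt0r A0 lp_norm_ge0.
have {}B0 : 0 < B by rewrite lt0r B0 lp_norm_ge0.
have aE : \sum_i `|a i| `^ r = A `^ r by exact: eqv.
have bE : \sum_i `|b i| `^ s = B `^ s by exact: eqv.
clearbody A B; rewrite -[leRHS]mulr1 -ler_pdivrMl ?mulr_gt0// mulr_sumr.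
(* Both normalized sums are 1, so the right side is 1/r + 1/s. What remains is Young's inequality,
   term by term. *)
have -> : 1 = \sum_i (((`|a i| / A) `^ r) / r + ((`|b i| / B) `^ s) / s).
  rewrite big_split -!mulr_suml /=.
  by rewrite !sum_powR_normalized// !mul1r.
apply: ler_sum => i _.
apply: le_trans (conjugate_powR _ _ _ _ _) => //;
  rewrite ?divr_ge0 ?(ltW A0) ?(ltW B0)//.
by rewrite normrM invfM mulrACA [A^-1 * _]mulrC [B^-1 * _]mulrC.
Qed.

(** The witness is the equality case of Hoelder: the signs of [a] for p = 1, a signed unit vector at
    a maximal coordinate for p = +oo, and otherwise the signed power of exponent r - 1 of the
    normalized moduli. *)
Lemma lp_norm_attained p n (a : 'I_n -> R) : (1 <= p)%E ->
  exists2 b : 'I_n -> R, lp_norm (hoelder_conjugate p) b <= 1 & lp_norm p a = \sum_i a i * b i.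
Proof.
move=> p1; have [[-> ->]|[-> ->]|] := hoelder_conjugate_cases p1.
- exists (fun i => sgr (a i)).
    by apply: bigmax_le => // i _; rewrite normr_sg lern1; case: (_ != _).
  rewrite /= invr1 powRr1; last exact: sum_powR_ge0.
  by apply: eq_bigr => i _; rewrite powRr1// normrEsg mulrC.
- case: n a => [|n] a.
    exists (fun=> 0); last by rewrite /= !big_ord0.
    by rewrite /= big_ord0 powR0 ?invr_eq0 ?oner_neq0.
  have [j _ jE] := @Order.TotalTheory.eq_bigmax _ R _ 0 ord0 xpredT
    (fun i => `|a i|) isT (fun i _ => normr_ge0 (a i)).
  exists (fun i => sgr (a j) *+ (i == j)).
    rewrite /= invr1 powRr1; last exact: sum_powR_ge0.
    rewrite (bigD1 j)//= big1 ?addr0 => [|i /negbTE ->].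
      by rewrite eqxx powRr1// normr_sg lern1; case: (_ != _).
    by rewrite normr0 powR0 ?oner_neq0.
  rewrite (bigD1 j)//= big1 ?addr0 => [|i /negbTE ->]; last by rewrite mulr0.
  by rewrite eqxx mulr1n jE normrEsg mulrC.
move=> [r [s [-> -> r1 s1 rs]]].
have [r0 s0] : 0 < r /\ 0 < s by split; lra.
set A := lp_norm r%:E a.
have AE : \sum_i `|a i| `^ r = A `^ r.
  by rewrite /A/= -powRrM mulVf ?gt_eqF// powRr1// sum_powR_ge0.
have [A0|A0] := eqVneq A 0.
  exists (fun=> 0); last by rewrite A0 big1// => i _; rewrite mulr0.
  rewrite /= big1 ?powR0 ?invr_eq0 ?gt_eqF// => i _.
  by rewrite normr0 powR0 ?gt_eqF.
have {}A0 : 0 < A by rewrite lt0r A0 lp_norm_ge0.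
clearbody A; exists (fun i => sgr (a i) * (`|a i| / A) `^ (r - 1)).
  (* By this identity the [s]-power sum of the witness is at most the normalized [r]-power sum,
     which is 1. *)
  have rs' : (r - 1) * s = r.
    have := congr1 (fun z => z * (r * s)) rs.
    rewrite mulrDl mulrA mulVf ?gt_eqF// mul1r (mulrC r) mulrA mulVf ?gt_eqF//; lra.
  rewrite /=; apply: le_trans (_ : 1 `^ s^-1 <= 1); last by rewrite powR1.
  apply: le_powR; [by rewrite invr_ge0 ltW|exact: sum_powR_ge0|].
  apply: (@le_trans _ _ (\sum_i (`|a i| / A) `^ r)).
    apply: ler_sum => i _; rewrite -{2}rs' powRrM normrM normr_sg.
    apply: le_powR; rewrite ?mulr_ge0 ?powR_ge0 ?(ltW s0)//.
    by rewrite (ger0_norm (powR_ge0 _ _)) ler_piMl ?powR_ge0// lern1; case: (_ != _).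
  by rewrite sum_powR_normalized.
transitivity (A * \sum_i (`|a i| / A) `^ r).
  by rewrite sum_powR_normalized// mulr1.
rewrite mulr_sumr; apply: eq_bigr => i _.
rewrite mulrA (mulrC (a i)) -normrEsg -(@mulr_powRB1 _ _ r) ?divr_ge0 ?(ltW A0)//.
by rewrite mulrA mulrCA divff ?gt_eqF// mulr1.
Qed.

(** With moduli in the dual sum, monotonicity, the triangle inequality and the comparison with the
    l_1 norm become termwise estimates, for all [p] at once. *)
Lemma le_lp_normP p n (a : 'I_n -> R) (K : R) : (1 <= p)%E ->
  (forall b : 'I_n -> R, lp_norm (hoelder_conjugate p) b <= 1 -> \sum_i `|a i| * `|b i| <= K) ->
  lp_norm p a <= K.
Proof.
move=> p1 aK; have [b b1 ->] := lp_norm_attained a p1.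
apply: le_trans (aK b b1); apply: ler_sum => i _.
by rewrite -normrM ler_norm.
Qed.

Lemma lp_norm_sumM_le p n (a b : 'I_n -> R) (K : R) : (1 <= p)%E ->
  lp_norm p a <= K -> lp_norm (hoelder_conjugate p) b <= 1 -> \sum_i `|a i| * `|b i| <= K.
Proof.
move=> p1 aK b1; under eq_bigr do rewrite -normrM.
apply: (le_trans (lp_norm_hoelder a b p1)).
by apply: le_trans aK; rewrite ler_piMr ?lp_norm_ge0.
Qed.

Lemma ler_lp_norm p n (a b : 'I_n -> R) : (1 <= p)%E ->
  (forall i, `|a i| <= `|b i|) -> lp_norm p a <= lp_norm p b.
Proof.
move=> p1 ab; apply: le_lp_normP => // c c1.
apply: le_trans (lp_norm_sumM_le p1 (lexx _) c1).
by apply: ler_sum => i _; rewrite ler_wpM2r.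
Qed.

Lemma ler_lp_normD p n (a b : 'I_n -> R) : (1 <= p)%E ->
  lp_norm p (fun i => a i + b i) <= lp_norm p a + lp_norm p b.
Proof.
move=> p1; apply: le_lp_normP => // c c1.
apply: le_trans (lerD (lp_norm_sumM_le p1 (lexx _) c1)
  (lp_norm_sumM_le p1 (lexx _) c1)).
rewrite -big_split; apply: ler_sum => i _ /=.
by rewrite -mulrDl ler_wpM2r// ler_normD.
Qed.

Lemma lp_norm_le_sum p n (a : 'I_n -> R) : (1 <= p)%E ->
  lp_norm p a <= \sum_i `|a i|.
Proof.
move=> p1; apply: le_lp_normP => // c c1; apply: ler_sum => i _.
rewrite ler_piMr//; apply: le_trans c1.
by apply: coord_le_lp_norm; exact: hoelder_conj_ge1.
Qed.

End LpNorm.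

(** * Hahn-Banach through minimal sublinear functionals *)

Section Sublinear.
Context {R : realType} {V : lmodType R}.

Definition sublinear (q : V -> R) :=
  (forall x y, q (x + y) <= q x + q y) /\
  (forall t x, 0 <= t -> q (t *: x) <= t * q x).

Lemma sublinear0 q : sublinear q -> q 0 = 0.
Proof.
move=> [qD qZ]; apply/eqP; rewrite eq_le; apply/andP; split.
  by have := qZ 0 0 (lexx _); rewrite scale0r mul0r.
by have := qD 0 0; rewrite addr0; lra.
Qed.

Lemma sublinearZ q t x : sublinear q -> 0 <= t -> q (t *: x) = t * q x.
Proof.
move=> qs t0; have [->|tn0] := eqVneq t 0.
  by rewrite scale0r mul0r sublinear0.
apply/eqP; rewrite eq_le (qs.2 t x t0)/= -ler_pdivlMl ?lt0r ?tn0//.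
have := qs.2 t^-1 (t *: x); rewrite scalerA mulVf// scale1r; apply.
by rewrite invr_ge0.
Qed.

Lemma sublinear_geN q x : sublinear q -> - q (- x) <= q x.
Proof.
by move=> qs; have := qs.1 x (- x); rewrite subrr sublinear0//; lra.
Qed.

(** Common source of three later infima: along a direction, over a chain, and in the extension of a
    functional. The last two hypotheses force the value 0 at 0, which settles the case t = 0. *)
Lemma inf_sublinear {I : Type} (P : set I) (F : I -> V -> R) :
  (forall x, has_lbound [set F i x | i in P]) ->
  (forall i j x y, P i -> P j -> exists2 k, P k & F k (x + y) <= F i x + F j y) ->
  (forall t i x, P i -> 0 < t -> exists2 k, P k & F k (t *: x) <= t * F i x) ->
  (forall i, P i -> 0 <= F i 0) -> (exists2 i, P i & F i 0 <= 0) ->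
  sublinear (fun x => inf [set F i x | i in P]).
Proof.
move=> Flb FD FZ F0 [j0 Pj0 Fj0].
have Fne x : [set F i x | i in P] !=set0 by exists (F j0 x), j0.
have le x k : P k -> inf [set F i x | i in P] <= F k x.
  by move=> Pk; apply: ge_inf => //; exists k.
have inf0 : inf [set F i 0 | i in P] = 0.
  apply/eqP; rewrite eq_le (le_trans (le _ _ Pj0))//=.
  by apply: lb_le_inf => // _ [i Pi <-]; exact: F0.
split=> [x y|t x].
  apply/ler_addgt0Pr => e e0.
  have e2 : 0 < e / 2 by rewrite divr_gt0.
  have [_ [i Pi <-] Fi] := inf_adherent e2 (conj (Fne x) (Flb x)).
  have [_ [j Pj <-] Fj] := inf_adherent e2 (conj (Fne y) (Flb y)).
  have [k Pk Fk] := FD i j x y Pi Pj.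
  apply: (le_trans (le _ _ Pk)); apply: (le_trans Fk).
  move: Fi Fj; lra.
rewrite le_eqVlt => /predU1P[<-|t0]; first by rewrite scale0r mul0r inf0.
rewrite -ler_pdivrMl//; apply: lb_le_inf => // _ [i Pi <-].
have [k Pk Fk] := FZ t i x Pi t0.
by rewrite ler_pdivrMl//; apply: le_trans Fk; exact: le.
Qed.

Lemma minimal_sublinear_linear (q : V -> R) : sublinear q ->
  (forall q', sublinear q' -> (forall x, q' x <= q x) -> forall x, q x <= q' x) ->
  linear (q : V -> R^o).
Proof.
move=> qs qmin.
have qD x y : q (x + y) = q x + q y.
  apply/eqP; rewrite eq_le qs.1 /=.
  (* Lower [q] in the direction [y]. The infimum over t >= 0 is sublinear and at most [q] (t = 0),
     so minimality puts [q] below it; t = 1 then gives q x + q y <= q (x + y). *)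
  pose F (t : R) (z : V) := q (z + t *: y) - t * q y.
  pose P := [set t : R | 0 <= t].
  have Flb z : lbound [set F t z | t in P] (- q (- z)).
    move=> _ [t t0 <-]; rewrite /F -(sublinearZ _ qs t0).
    have := qs.1 (z + t *: y) (- z); rewrite addrAC subrr add0r; lra.
  have P0 : P 0 by rewrite /P /=.
  have F00 : F 0 0 = 0 by rewrite /F scale0r addr0 mul0r subr0 sublinear0.
  have q's : sublinear (fun z => inf [set F t z | t in P]).
    apply: inf_sublinear.
    - by move=> z; exists (- q (- z)); exact: Flb.
    - move=> s t z w s0 t0; exists (s + t); first exact: addr_ge0.
      rewrite /F scalerDl addrACA mulrDl.
      by have := qs.1 (z + s *: y) (w + t *: y); lra.
    - move=> s t z t0 s0; exists (s * t); first by rewrite /P/= mulr_ge0// ltW.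
      by rewrite /F -scalerA -scalerDr (sublinearZ _ qs (ltW s0)) mulrBr mulrA.
    - by move=> t t0; rewrite /F add0r (sublinearZ _ qs t0) subrr.
    - by exists 0; rewrite ?F00.
  have le z t : 0 <= t -> inf [set F t z | t in P] <= F t z.
    move=> t0; apply: ge_inf; last by exists t.
    by exists (- q (- z)); exact: Flb.
  have q'q z : inf [set F t z | t in P] <= q z.
    by have := le z 0 (lexx _); rewrite {2}/F scale0r addr0 mul0r subr0.
  have := le_trans (qmin _ q's q'q x) (le x 1 ler01).
  by rewrite /F scale1r mul1r; lra.
have q0 := sublinear0 qs.
have qN x : q (- x) = - q x.
  by apply/eqP; rewrite -addr_eq0 -qD addNr q0.
move=> t x y; rewrite qD; congr (_ + _); rewrite /GRing.scale /=.
have [t0|t0] := leP 0 t; first by rewrite sublinearZ.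
by rewrite -[LHS]opprK -qN -scaleNr sublinearZ// ?mulNr ?opprK// oppr_ge0 ltW.
Qed.

(** Zorn's lemma yields a minimal sublinear functional below [q]. No subspace appears: a functional
    to be extended is later encoded in the choice of [q]. *)
Lemma linear_below_sublinear (q : V -> R) : sublinear q ->
  exists2 L : V -> R^o, linear L & forall x, L x <= q x.
Proof.
move=> qs.
pose T := {f : V -> R | sublinear f /\ forall x, f x <= q x}.
(* The pointwise order is reversed, so a maximal element for [Rl] is a minimal functional and a
   chain is bounded by its pointwise infimum. *)
pose Rl : rel T := fun f g => `[< forall x, sval g x <= sval f x >].
have Tlb (f : T) x : - q (- x) <= sval f x.
  case: f => f [fs fq] /=; apply: le_trans (sublinear_geN x fs).
  by rewrite lerN2.
have [|||[f [fs fq]] fmin] := @ZL_preorder T (exist _ q (conj qs (fun x => lexx (q x)))) Rl.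
- by move=> f; apply/asboolP => x.
- move=> f g h /asboolP gf /asboolP fh; apply/asboolP => x.
  exact: le_trans (fh x) (gf x).
- move=> A Atot.
  have [A0|/set0P[f0 Af0]] := eqVneq A set0.
    by exists (exist _ q (conj qs (fun x => lexx (q x)))) => f; rewrite A0.
  have Alb x : has_lbound [set sval f x | f in A].
    by exists (- q (- x)) => _ [f _ <-]; exact: Tlb.
  have le x (f : T) : A f -> inf [set sval f x | f in A] <= sval f x.
    by move=> Af; apply: ge_inf => //; exists f.
  have h : sublinear (fun x => inf [set sval f x | f in A]).
    apply: inf_sublinear => //.
    - move=> f g x y Af Ag; have [/asboolP fg|/asboolP gf] := Atot _ _ Af Ag.
        exists g => //; case: g fg {Ag} => g [gs gq] /= fg.
        by apply: (le_trans (gs.1 _ _)); rewrite lerD2r.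
      exists f => //; case: f gf {Af} => f [fs fq] /= gf.
      by apply: (le_trans (fs.1 _ _)); rewrite lerD2l.
    - move=> t f x Af t0; exists f => //; case: f {Af} => f [fs fq] /=.
      by apply: fs.2; rewrite ltW.
    - by move=> f Af; rewrite (sublinear0 (svalP f).1).
    - by exists f0 => //; rewrite (sublinear0 (svalP f0).1).
  have hq x : inf [set sval f x | f in A] <= q x.
    by apply: (le_trans (le x f0 Af0)); exact: (svalP f0).2.
  pose g0 : T := exist _ (fun x => inf [set sval f x | f in A]) (conj h hq).
  exists g0 => f Af; apply/asboolP => x /=.
  exact: le.
exists f => //; apply: minimal_sublinear_linear => // g gs gf x.
have gq y : g y <= q y := le_trans (gf y) (fq y).
pose g0 : T := exist _ g (conj gs gq).
by have /asboolP := fmin g0 (asboolT gf); exact.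
Qed.

End Sublinear.

(** * Nearly norming vectors and strong norms of functionals *)

Section DualNorm.
Context {R : realType} {E : normedModType R}.

Lemma dual_norm_approx (phi : dual E) (e : R) : 0 < e ->
  exists2 x : E, `|x| <= 1 & op_norm phi - e <= phi x.
Proof.
move=> e0; have [_ [x /= x1 <-] phix] := sup_adherent e0 (op_norm_has_sup phi).
have [phi0|phi0] := leP 0 (phi x : R).
  by exists x => //; rewrite -[phi x](ger0_norm phi0) ltW.
exists (- x); first by rewrite normrN.
by rewrite linearN -[- phi x](ltr0_norm phi0) ltW.
Qed.

(** Scaling a nearly norming vector of each [D i] by the modulus of a dual weight [b i] turns the
    dual sum of the norms into a pairing, up to a small error. *)
Lemma lp_norm_le_pairing (p : \bar R) n (D : 'I_n -> dual E) (K : R) :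
  (1 <= p)%E -> 0 <= K ->
  (forall g : 'I_n -> E, \sum_i (D i (g i) : R) <=
    K * strong_lp (hoelder_conjugate p) g) ->
  lp_norm p (fun i => op_norm (D i)) <= K.
Proof.
move=> p1 K0 DK; have q1 := hoelder_conj_ge1 p1.
apply: le_lp_normP => // b b1; apply/ler_addgt0Pr => e e0.
have b0 : 0 <= \sum_i `|b i| by apply: sumr_ge0.
(* Chosen so that the errors, weighted by [b], add up to at most [e]; the 1 keeps the denominator
   positive when [b] vanishes. *)
pose d := e / (\sum_i `|b i| + 1).
have d0 : 0 < d by rewrite divr_gt0// ltr_wpDl.
have /choice[x Dx] i : exists x : E, `|x| <= 1 /\ op_norm (D i) - d <= D i x.
  by have [x x1 Dx] := dual_norm_approx (D i) d0; exists x.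
pose g i := `|b i| *: x i.
have gb : strong_lp (hoelder_conjugate p) g <= 1.
  apply: le_trans b1; apply: ler_lp_norm => // i.
  by rewrite normr_id normrZ normr_id ler_piMr//; have [] := Dx i.
apply: (@le_trans _ _ (\sum_i ((D i (g i) : R) + d * `|b i|))).
  apply: ler_sum => i _; rewrite /g linearZ /= -[_ *: _]/(`|b i| * (D i (x i) : R)).
  rewrite (ger0_norm (op_norm_ge0 _)) (mulrC d) -mulrDr mulrC ler_wpM2l//.
  by rewrite -lerBlDr; have [] := Dx i.
rewrite big_split -mulr_sumr; apply: lerD.
  by apply: (le_trans (DK g)); rewrite ler_piMr.
by rewrite /d mulrAC ler_pdivrMr ?ltr_wpDl// ler_wpM2l ?ltW// ltrDl.
Qed.

End DualNorm.

(** * The weak l_p norm *)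

Section WeakNorm.
Context {R : realType} {E : normedModType R}.
Variables (p : \bar R) (p1 : (1 <= p)%E).

Let weak_lp_has_sup n (e : 'I_n -> E) : has_sup
  [set lp_norm p (fun i => phi (e i) : R) | phi in [set phi : dual E | `|phi| <= 1]].
Proof.
split; first by exists (lp_norm p (fun i => (0 : dual E) (e i) : R)), 0;
  rewrite //= normr0.
exists (strong_lp p e) => _ [phi /= phi1 <-].
apply: ler_lp_norm => // i; rewrite normr_id.
by apply: (le_trans (op_normP phi _)); rewrite ler_piMl.
Qed.

Lemma le_weak_lp n (e : 'I_n -> E) (phi : dual E) : `|phi| <= 1 ->
  lp_norm p (fun i => phi (e i) : R) <= weak_lp p e.
Proof.
by move=> phi1; apply: ub_le_sup; [case: (weak_lp_has_sup e)|exists phi].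
Qed.

Lemma weak_lp_le n (e : 'I_n -> E) (K : R) :
  (forall phi : dual E, `|phi| <= 1 -> lp_norm p (fun i => phi (e i) : R) <= K) ->
  weak_lp p e <= K.
Proof.
move=> eK; apply: ge_sup; first by case: (weak_lp_has_sup e).
by move=> _ [phi /= phi1 <-]; exact: eK.
Qed.

Lemma weak_lp_ge0 n (e : 'I_n -> E) : 0 <= weak_lp p e.
Proof.
have := @le_weak_lp n e 0; rewrite normr0 => /(_ ler01); apply: le_trans.
exact: lp_norm_ge0.
Qed.

Lemma weak_lp_pairing n (e : 'I_n -> E) (b : 'I_n -> R) (phi : dual E) :
  lp_norm (hoelder_conjugate p) b <= 1 ->
  \sum_i b i * (phi (e i) : R) <= op_norm phi * weak_lp p e.
Proof.
move=> b1; have [phi0|phi0] := eqVneq (op_norm phi) 0.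
  rewrite phi0 mul0r big1// => i _.
  by rewrite (op_norm0_eq0 phi0) -[X in _ * X]/0 mulr0.
have {}phi0 : 0 < op_norm phi by rewrite lt0r phi0 op_norm_ge0.
pose psi : dual E := (op_norm phi)^-1 *: phi.
have psi1 : `|psi| <= 1.
  rewrite normrZ -[X in _ * X]/(op_norm phi) ger0_norm ?mulVf ?gt_eqF//.
  by rewrite invr_ge0 ltW.
have := lp_norm_sumM_le p1 (le_weak_lp e psi1) b1.
rewrite -ler_pdivrMl// mulr_sumr; apply: le_trans; apply: ler_sum => i _.
rewrite -normrM mulrCA; apply: le_trans (ler_norm _) _.
by rewrite mulrC.
Qed.

(** Dualizing the l_p norm of the values of [phi] moves the weights inside [phi], so the weak norm
    is controlled by norms of combinations. *)
Lemma weak_lp_le_combination n (e : 'I_n -> E) (K : R) :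
  (forall b : 'I_n -> R, lp_norm (hoelder_conjugate p) b <= 1 ->
    `|\sum_i b i *: e i| <= K) ->
  weak_lp p e <= K.
Proof.
move=> eK; apply: weak_lp_le => phi phi1.
have [b b1 ->] := lp_norm_attained (fun i => phi (e i) : R) p1.
apply: le_trans (eK b b1).
have -> : \sum_i (phi (e i) : R) * b i = phi (\sum_i b i *: e i).
  by rewrite linear_sum; apply: eq_bigr => i _; rewrite linearZ mulrC.
apply: le_trans (ler_norm _) (le_trans (op_normP _ _) _).
by rewrite ler_piMl.
Qed.

(** Allows elements of F(X) to be replaced by nearby finite combinations of deltas. *)
Lemma weak_lp_perturb n (e e' : 'I_n -> E) :
  weak_lp p e <= weak_lp p e' + \sum_i `|e i - e' i|.
Proof.
apply: weak_lp_le => phi phi1.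
pose d i : R := phi (e i - e' i).
have -> : (fun i => phi (e i) : R) = (fun i => (phi (e' i) : R) + d i).
  by apply/funext => i; rewrite /d linearB /= [RHS]addrC subrK.
apply: (le_trans (ler_lp_normD _ _ p1)); apply: lerD; first exact: le_weak_lp.
apply: (le_trans (lp_norm_le_sum _ p1)); apply: ler_sum => i _.
by apply: (le_trans (op_normP _ _)); rewrite ler_piMl.
Qed.

End WeakNorm.

(** * Finite nets of l_p balls *)

Section LpNet.
Context {R : realType}.

(* Unit vectors belong to the net, so bounding a combination over the net
   already bounds each term. *)
Lemma lp_ball_net (p : \bar R) n : (1 <= p)%E ->
  exists (K : finType) (b : K -> 'I_n -> R),
  [/\ forall k, lp_norm p (b k) <= 1,
      forall j, exists k, forall i, b k i = (i == j)%:R &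
      forall c, lp_norm p c <= 1 ->
        exists k, forall i, `|c i - b k i| <= n%:R^-1].
Proof.
move=> p1; have q1 := hoelder_conj_ge1 p1.
(* Grid points have coordinates +j/n or -j/n with j <= n; those outside the ball are replaced by 0
   in [b], so that every index gives a point of the ball. *)
pose grid (k : {ffun 'I_n -> bool * 'I_n.+1}) (i : 'I_n) : R :=
  (-1) ^+ (k i).1 * ((k i).2%:R / n%:R).
pose b (k : 'I_n + {ffun 'I_n -> bool * 'I_n.+1}) : 'I_n -> R := match k with
  | inl j => fun i => (i == j)%:R
  | inr k => if lp_norm p (grid k) <= 1 then grid k else fun=> 0 end.
exists ('I_n + {ffun 'I_n -> bool * 'I_n.+1})%type, b; split.
- case=> [j|k]; last first.
    rewrite /b; case: ifP => // _.
    apply: (le_trans (lp_norm_le_sum _ p1)).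
    by rewrite big1// => i _; rewrite normr0.
  apply: le_lp_normP => // c c1.
  rewrite (bigD1 j)//= big1 ?addr0 ?eqxx ?normr1 ?mul1r.
    exact: le_trans (coord_le_lp_norm _ _ q1) c1.
  by move=> i /negbTE ->; rewrite normr0 mul0r.
- by move=> j; exists (inl j).
move=> c c1.
have cle i : `|c i| <= 1 := le_trans (coord_le_lp_norm c i p1) c1.
have t0 i : 0 <= n%:R * `|c i| by rewrite mulr_ge0.
have tle i : (Num.truncn (n%:R * `|c i|) < n.+1)%N.
  rewrite ltnS -(ler_nat R); apply: (@le_trans _ _ (n%:R * `|c i|)).
    by rewrite Num.Theory.truncn_le.
  by rewrite ler_piMr.
(* Rounding toward zero shrinks every modulus, so the grid point stays in the ball, and it moves
   each coordinate by at most 1/n. *)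
pose k := [ffun i => (c i < 0, Ordinal (tle i))].
have cE i : c i = (-1) ^+ (c i < 0)%R * `|c i| by rewrite -numEsign.
have n0 (i : 'I_n) : (0 : R) < n%:R by rewrite ltr0n; case: i => m; case: (n).
have gridE i : grid k i = (-1) ^+ (c i < 0)%R * ((Num.truncn (n%:R * `|c i|))%:R / n%:R).
  by rewrite /grid ffunE.
have k1 : lp_norm p (grid k) <= 1.
  apply: le_trans c1; apply: ler_lp_norm => // i.
  rewrite gridE normrM normrX normrN1 expr1n mul1r ger0_norm ?divr_ge0//.
  by rewrite ler_pdivrMr ?n0// mulrC Num.Theory.truncn_le.
exists (inr k) => i; rewrite /b k1 gridE {1}cE -mulrBr.
rewrite normrM normrX normrN1 expr1n mul1r.
have /andP[lo hi] := Num.Theory.truncn_itv (t0 i).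
rewrite -{1}[`|c i|](mulKf (lt0r_neq0 (n0 i))) (mulrC _^-1) -mulrBl.
rewrite normrM [X in _ * X]ger0_norm ?invr_ge0//.
rewrite ler_piMl ?invr_ge0// ger0_norm ?subr_ge0//.
by rewrite lerBlDl -natr1 in hi *; rewrite ltW.
Qed.

(** A point of the ball differs from a net point by at most 1/n in each of [n] coordinates, and unit
    vectors in the net bound each [e i] by [M]. The error is thus at most [M], whence the factor
    2. *)
Lemma weak_lp_net (p : \bar R) n : (1 <= p)%E ->
  exists (K : finType) (b : K -> 'I_n -> R),
  (forall k, lp_norm (hoelder_conjugate p) (b k) <= 1) /\
  forall (E : normedModType R) (e : 'I_n -> E) M, 0 <= M ->
    (forall k, `|\sum_i b k i *: e i| <= M) -> weak_lp p e <= 2 * M.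
Proof.
move=> p1; have [K [b [b1 bu bn]]] := lp_ball_net n (hoelder_conj_ge1 p1).
exists K, b; split => // E e M M0 eM; apply: weak_lp_le_combination => // c c1.
have eiM i : `|e i| <= M.
  have [k kE] := bu i; apply: le_trans (eM k).
  rewrite (bigD1 i)//= kE eqxx scale1r big1 ?addr0// => j /negbTE ji.
  by rewrite kE ji scale0r.
have [k ck] := bn c c1.
rewrite -[X in `|X|](subrK (\sum_i b k i *: e i)) -sumrB.
apply: (le_trans (ler_normD _ _)); rewrite mulrDl mul1r; apply: lerD => //.
apply: (le_trans (ler_norm_sum _ _ _)).
apply: (@le_trans _ _ (\sum_(i < n) n%:R^-1 * M)).
  by apply: ler_sum => i _; rewrite -scalerBl normrZ ler_pM.
rewrite sumr_const card_ord -[leLHS]mulr_natl mulrA.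
case: n {K b b1 bu bn e eM c c1 eiM k ck} => [|n]; first by rewrite !mul0r.
by rewrite mulfV ?mul1r ?pnatr_eq0.
Qed.

End LpNet.

(** * Functionals on a finite max-norm power *)

Section ProductFunctional.
Context {R : realType} {E : normedModType R} {K : finType}.
Implicit Types v w : K -> E.

Definition max_norm v : R := \big[maxr/0]_k `|v k|.

Lemma max_norm_ge0 v : 0 <= max_norm v.
Proof. exact: bigmax_ge_id. Qed.

Lemma le_max_norm v k : `|v k| <= max_norm v.
Proof. exact: (le_bigmax _ (fun k => `|v k|)). Qed.

Lemma max_norm_le v (M : R) : 0 <= M -> (forall k, `|v k| <= M) -> max_norm v <= M.
Proof. by move=> M0 vM; apply: bigmax_le. Qed.

(** The dual of the max-norm power is the l_1 sum of the duals: evaluating [L] at a vector whose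
    coordinates nearly norm the [h k] bounds the sum of their norms. *)
Lemma max_norm_linear_form (L : (K -> E) -> R^o) (M : R) : 0 <= M -> linear L ->
  (forall v, L v <= M * max_norm v) ->
  exists2 h : K -> dual E, \sum_k op_norm (h k) <= M &
    forall v, L v = \sum_k h k (v k).
Proof.
move=> M0 Llin LM.
pose L' : {linear (K -> E) -> R^o} :=
  HB.pack L (GRing.isLinear.Build R (K -> E) R^o _ L Llin).
pose inj k x : K -> E := fun j => if j == k then x else 0.
have inj_lin k a x y : inj k (a *: x + y) = a *: inj k x + inj k y.
  apply/funext => j; rewrite /inj !fctE; case: ifP => // _.
  by rewrite scaler0 addr0.
have inj_norm k x : max_norm (inj k x) = `|x|.
  apply/eqP; rewrite eq_le; apply/andP; split.
    by apply: max_norm_le => // j; rewrite /inj; case: ifP => // _; rewrite normr0.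
  by have := le_max_norm (inj k x) k; rewrite /inj eqxx.
have hb k : (fun x => L (inj k x)) \in @bounded_op R E R^o.
  apply/asboolP; split; first by move=> a x y; rewrite inj_lin Llin.
  exists M => x; rewrite -(inj_norm k x) ler_norml LM andbT.
  have := LM (- inj k x); rewrite -[L (- _)]/(L' _) linearN /=.
  have -> : max_norm (- inj k x) = max_norm (inj k x).
    by apply: eq_bigr => j _; rewrite fctE normrN.
  by rewrite lerNl.
pose h k : dual E := Bop (hb k).
have LE v : L v = \sum_k h k (v k).
  have -> : v = \sum_k inj k (v k).
    apply/funext => j; rewrite fct_sumE (bigD1 j)//= /inj eqxx big1 ?addr0// => i ij.
    by rewrite eq_sym (negbTE ij).
  rewrite -[LHS]/(L' _) linear_sum; apply: eq_bigr => k _.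
  congr (L (inj k _)); rewrite fct_sumE (bigD1 k)//= /inj eqxx big1 ?addr0// => i ij.
  by rewrite eq_sym (negbTE ij).
exists h => //; apply/ler_addgt0Pr => e e0.
pose d := e / (#|K|%:R + 1).
have K0 : 0 < #|K|%:R + 1 :> R by rewrite ltr_wpDl.
have d0 : 0 < d by rewrite divr_gt0.
have /choice[x hx] k : exists x : E, `|x| <= 1 /\ op_norm (h k) - d <= h k x.
  by have [x x1 xh] := dual_norm_approx (h k) d0; exists x.
apply: (@le_trans _ _ (\sum_k ((h k (x k) : R) + d))).
  by apply: ler_sum => k _; rewrite -lerBlDr; have [] := hx k.
rewrite big_split sumr_const /=; apply: lerD.
  rewrite -[leLHS]/(\sum_k h k (x k) : R) -LE; apply: (le_trans (LM x)).
  rewrite ler_piMr//; apply: max_norm_le => // k; by have [] := hx k.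
rewrite -[leLHS]mulr_natl /d mulrCA ler_piMr ?(ltW e0)//.
by rewrite ler_pdivrMr// mul1r lerDl.
Qed.

End ProductFunctional.

(** * Decomposition of functionals bounded for the weak norm *)

Section FiniteDuality.
Context {R : realType} {E : normedModType R}.

(* E^n with the weak l_p norm embeds, up to the factor 2, in the max-norm
   product of copies of E indexed by a net of the l_q ball, where a functional is a sum
   of functionals on the factors. *)
Lemma weak_lp_functional (p : \bar R) n (f : 'I_n -> dual E) (N : R) :
  (1 <= p)%E -> 0 <= N ->
  (forall m : 'I_n -> E, \sum_i (f i (m i) : R) <= N * weak_lp p m) ->
  exists (K : finType) (b : K -> 'I_n -> R) (h : K -> dual E),
  [/\ forall k, lp_norm (hoelder_conjugate p) (b k) <= 1,
      \sum_k op_norm (h k) <= 2 * N &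
      forall i, f i = \sum_k b k i *: h k].
Proof.
move=> p1 N0 fN; have [K [b [b1 bw]]] := weak_lp_net n p1.
pose J (m : 'I_n -> E) : K -> E := fun k => \sum_i b k i *: m i.
pose S (m : 'I_n -> E) : R := \sum_i (f i (m i) : R).
have SD m m' : S (m + m') = S m + S m'.
  by rewrite /S -big_split; apply: eq_bigr => i _; rewrite fctE linearD.
have SZ t m : S (t *: m) = t * S m.
  by rewrite /S mulr_sumr; apply: eq_bigr => i _; rewrite fctE linearZ.
have JD m m' : J (m + m') = J m + J m'.
  apply/funext => k; rewrite -[RHS]/(J m k + J m' k) -big_split; apply: eq_bigr => i _.
  by rewrite fctE scalerDr.
have JZ t m : J (t *: m) = t *: J m.
  apply/funext => k; rewrite -[RHS]/(t *: J m k) scaler_sumr; apply: eq_bigr => i _.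
  by rewrite fctE !scalerA mulrC.
have nD (v w : K -> E) : max_norm (v + w) <= max_norm v + max_norm w.
  apply: max_norm_le => [|k]; first by rewrite addr_ge0 ?max_norm_ge0.
  by apply: (le_trans (ler_normD _ _)); apply: lerD; exact: le_max_norm.
have nZ t (v : K -> E) : 0 <= t -> max_norm (t *: v) <= t * max_norm v.
  move=> t0; apply: max_norm_le => [|k]; first by rewrite mulr_ge0 ?max_norm_ge0.
  by rewrite fctE normrZ ger0_norm// ler_wpM2l// le_max_norm.
have nN (v : K -> E) : max_norm (- v) = max_norm v.
  by apply: eq_bigr => k _; rewrite fctE normrN.
(* This is [fN] at -m, with the weak norm bounded through the net. It keeps the infimum of [F]
   finite. *)
have S_ge m : - (2 * N * max_norm (J m)) <= S m.
  rewrite lerNl; apply: (@le_trans _ _ (S ((-1) *: m))).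
    by rewrite SZ mulN1r.
  apply: (le_trans (fN _)); rewrite (mulrC 2) -mulrA ler_wpM2l//.
  apply: bw => [|k]; first exact: max_norm_ge0.
  rewrite -[X in `|X|]/(J (-1 *: m) k) JZ scaleN1r fctE normrN.
  exact: le_max_norm.
(* A linear [L] below the infimum over [m] is bounded by 2 N [max_norm] (take m = 0) and by [S m] at
   [J m] (take v = J m). *)
pose F (m : 'I_n -> E) (v : K -> E) : R := S m + 2 * N * max_norm (v - J m).
have N20 : 0 <= 2 * N by rewrite mulr_ge0.
have F_ge m v : - (2 * N * max_norm v) <= F m v.
  have := S_ge m; have := nD (- v) (v - J m).
  rewrite addrA addNr add0r !nN => /(ler_wpM2l N20); rewrite /F mulrDr; lra.
have J0 : J 0 = 0 by rewrite -(scale0r 0) JZ scale0r.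
have S0 : S 0 = 0 by rewrite -(scale0r 0) SZ mul0r.
have n0 : max_norm (0 : K -> E) = 0.
  by apply/eqP; rewrite eq_le max_norm_ge0 andbT max_norm_le// => k; rewrite normr0.
have Flb v : has_lbound [set F m v | m in [set: 'I_n -> E]].
  by exists (- (2 * N * max_norm v)) => _ [m _ <-].
have qs : sublinear (fun v => inf [set F m v | m in [set: 'I_n -> E]]).
  apply: inf_sublinear => //.
  - move=> m m' v w _ _; exists (m + m') => //.
    have := nD (v - J m) (w - J m'); rewrite /F SD JD opprD addrACA.
    by move=> /(ler_wpM2l N20); rewrite mulrDr; lra.
  - move=> t m v _ t0; exists (t *: m) => //.
    rewrite /F SZ JZ -scalerBr mulrDr lerD2l mulrCA ler_wpM2l//.
    by apply: nZ; exact: ltW.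
  - by move=> m _; apply: le_trans (F_ge m 0); rewrite n0 mulr0 oppr0.
  - by exists 0 => //; rewrite /F S0 J0 subr0 n0 mulr0 addr0.
have [L Llin Lle] := linear_below_sublinear qs.
have LF m v : L v <= F m v.
  by apply: (le_trans (Lle v)); apply: ge_inf => //; exists m.
have [|h hN Lh] := @max_norm_linear_form _ _ _ L (2 * N) N20 Llin.
  by move=> v; have := LF 0 v; rewrite /F S0 J0 subr0 add0r.
(* The inequality at -m gives the reverse one, so [L] extends [S] along [J]. *)
have LJ m : L (J m) = S m.
  have le m' : L (J m') <= S m' by have := LF m' (J m'); rewrite /F subrr n0 mulr0 addr0.
  apply/eqP; rewrite eq_le le /=.
  have := le ((-1) *: m); rewrite SZ JZ mulN1r.
  have -> : L (-1 *: J m) = - L (J m).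
    by have := Llin (-1) (J m) 0; rewrite addr0 => ->;
      have := Llin (-1) 0 0; rewrite scaler0 addr0 scaleN1r addNr => ->;
      rewrite addr0 scaleN1r.
  by rewrite lerN2.
exists K, b, h; split => // i; apply: bop_ext => x.
(* A family supported at the single index [i] isolates [f i]. *)
pose m : 'I_n -> E := fun j => if j == i then x else 0.
have -> : f i x = S m.
  rewrite /S (bigD1 i)//= /m eqxx big1 ?addr0// => j /negbTE ->.
  by rewrite linear0.
rewrite -LJ Lh.
have -> : (\sum_k b k i *: h k) x = \sum_k b k i *: h k x.
  exact: (big_morph (fun g : dual E => g x)).
apply: eq_bigr => k _; rewrite -linearZ; congr (h k _).
rewrite /J (bigD1 i)//= /m eqxx big1 ?addr0// => j /negbTE ->.
by rewrite scaler0.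
Qed.

End FiniteDuality.

Lemma sum_normM_le_strong_lp {R : realType} {E : normedModType R} (p : \bar R)
    n (D : 'I_n -> dual E) (g : 'I_n -> E) : (1 <= p)%E ->
  \sum_i `|D i (g i) : R| <=
    lp_norm p (fun i => op_norm (D i)) * strong_lp (hoelder_conjugate p) g.
Proof.
move=> p1.
apply: le_trans (lp_norm_hoelder (fun i => op_norm (D i)) (fun i => `|g i|) p1).
apply: ler_sum => i _; rewrite (ger0_norm (mulr_ge0 (op_norm_ge0 _) (normr_ge0 _))).
exact: op_normP.
Qed.

(** * The free space: density of finite combinations and duality with X^# *)

Section FreeSpaceTheory.
Context {R : realType} {X : pmetricType R}.

(** Combinations of all lengths are packed in one sigma type, so that [choice] can select one for
    each index. *)
Definition delta_comb (c : {k : nat & ('I_k -> R * (X * X))%type}) : free X :=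
  \sum_j (tagged c j).1 *: delta (tagged c j).2.1 (tagged c j).2.2.

Lemma delta_comb_dense (m : free X) (e : R) : 0 < e ->
  exists c, `|m - delta_comb c| < e.
Proof.
move=> e0; have /asboolP/closure_normP cm := freeP m.
have [_ [n [a [s [Ss ->]]]] mn] := cm _ e0.
have /choice[z zs] i : exists z : X * X, eval_diff z.1 z.2 = s i.
  by have [z _ zi] := Ss i; exists z.
exists (existT (fun k => 'I_k -> R * (X * X))%type n (fun i => (a i, z i))).
rewrite -[`|_|]/(`|free_val m - val (delta_comb _)|) /delta_comb raddf_sum /=.
by under eq_bigr do rewrite zs.
Qed.

Lemma norm_delta_le (x y : X) : `|delta x y| <= mdist x y.
Proof.
apply: op_norm_le => f f1; apply: (le_trans (lip_constP f x y)).
by rewrite ler_piMl ?mdist_ge0.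
Qed.

Lemma free_dual_is_lip0 (phi : dual (free X)) :
  (fun x => phi (delta_pt x)) \in @is_lip0 R X R^o.
Proof.
apply/asboolP; split.
  rewrite (_ : delta_pt point = 0) ?linear0//.
  by rewrite /delta_pt delta_ptB subrr.
exists (op_norm phi) => x y; rewrite -linearB -delta_ptB.
apply: (le_trans (op_normP _ _)).
by rewrite ler_wpM2l ?op_norm_ge0 ?norm_delta_le.
Qed.

(** One direction of the identification of F(X)^* with X^#; [eval_free] gives the other. *)
Definition lip0_of_dual (phi : dual (free X)) : lip0 X R^o :=
  Lip0 (free_dual_is_lip0 phi).

Lemma norm_lip0_of_dual (phi : dual (free X)) : `|lip0_of_dual phi| <= op_norm phi.
Proof.
apply: lip_const_le => [|x y]; first exact: op_norm_ge0.
rewrite -[lip0_of_dual _ x - _]/(phi (delta_pt x) - phi (delta_pt y)).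
rewrite -linearB -delta_ptB; apply: (le_trans (op_normP _ _)).
by rewrite ler_wpM2l ?op_norm_ge0 ?norm_delta_le.
Qed.

Lemma eval_free_bounded (f : lip0 X R^o) :
  (fun m : free X => free_val m f) \in @bounded_op R (free X) R^o.
Proof.
apply/asboolP; split => //.
by exists `|f| => m; rewrite mulrC; exact: op_normP.
Qed.

Definition eval_free (f : lip0 X R^o) : dual (free X) := Bop (eval_free_bounded f).

Lemma free_val_bounded : @free_val R X \in @bounded_op R (free X) (dual (lip0 X R^o)).
Proof.
apply/asboolP; split => //.
by exists 1 => m; rewrite mul1r.
Qed.

Definition free_val_op : bop (free X) (dual (lip0 X R^o)) := Bop free_val_bounded.

(** A functional of norm at most 1 on (X^#)^* restricts to one on F(X), so the embedding does not
    increase the weak norm. *)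
Lemma weak_lp_free_val (p : \bar R) n (m : 'I_n -> free X) : (1 <= p)%E ->
  weak_lp p (fun i => free_val (m i)) <= weak_lp p m.
Proof.
move=> p1; apply: weak_lp_le => // phi phi1.
apply: (@le_weak_lp R (free X) p p1 n m (adjoint_fun free_val_op phi)).
apply: op_norm_le => u u1; apply: (le_trans (op_normP phi _)).
by rewrite -[leRHS]mul1r ler_pM ?op_norm_ge0.
Qed.

End FreeSpaceTheory.

(** * Evaluation functionals in the bidual *)

Section Bidual.
Context {R : realType} {E : normedModType R}.

Lemma bidual_eval_bounded (x : E) :
  (fun phi : dual E => phi x) \in @bounded_op R (dual E) R^o.
Proof.
apply/asboolP; split => //.
by exists `|x| => phi; rewrite mulrC; exact: op_normP.
Qed.

Definition bidual_eval (x : E) : dual (dual E) := Bop (bidual_eval_bounded x).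

Lemma norm_bidual_eval (x : E) : op_norm (bidual_eval x) <= `|x|.
Proof.
apply: op_norm_le => phi phi1; apply: (le_trans (op_normP phi x)).
by rewrite ler_piMl.
Qed.

End Bidual.

(** * The bilinear form of the linearization *)

Section Pairing.
Context {R : realType} {X Y : pmetricType R} (T : lipop X Y).

(** Its value is also m(g o T). Bundled as a bilinear form, it is a point at which tensors can be
    evaluated. *)
Definition lin_pairing (m : free X) (g : lip0 Y R^o) : R^o :=
  free_val (linearization T m) g.

Lemma lin_pairing_bilinear : bilinear_for *:%R *:%R lin_pairing.
Proof.
split=> [g a m m'|m a g g']; first by rewrite /lin_pairing linearP.
by rewrite /lin_pairing linearP.
Qed.

HB.instance Definition _ :=
  bilinear_isBilinear.Build R (free X) (lip0 Y R^o) R^o *:%R *:%R lin_pairing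
    lin_pairing_bilinear.

End Pairing.

(** * The implications between (1), (2) and (3) *)

Section Equivalences.
Context {R : realType} {X Y : pmetricType R} (T : lipop X Y).
Variables (p : \bar R) (p1 : (1 <= p)%E).
Local Notation q := (hoelder_conjugate p).

Lemma sum_lin_pairing_tensor n (m : 'I_n -> free X) (e : 'I_n -> lip0 Y R^o)
    l (x y : 'I_l -> X) (g : 'I_l -> lip0 Y R^o) :
  \sum_i tensor (m i) (e i) = \sum_k tensor (delta (x k) (y k)) (g k) ->
  \sum_i lin_pairing T (m i) (e i) = \sum_k (g k (T (x k)) - g k (T (y k)) : R^o).
Proof.
pose B : {bilinear free X -> lip0 Y R^o -> R^o} := lin_pairing T.
by move=> me; have := congr1 (fun u => u B) me; rewrite !fct_sumE.
Qed.

Lemma p_summing_of_pairing (C : R) : 0 < C ->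
  (forall n (m : 'I_n -> free X) (g : 'I_n -> lip0 Y R^o),
    \sum_i (lin_pairing T (m i) (g i) : R) <= C * (weak_lp p m * strong_lp q g)) ->
  p_summing p (linearization T).
Proof.
move=> C0 TC; exists C => // n m.
apply: (@lp_norm_le_pairing R _ p n (fun i => free_val (linearization T (m i)))) => //.
  by rewrite mulr_ge0 ?(ltW C0) ?weak_lp_ge0.
by move=> g; rewrite -mulrA; exact: TC.
Qed.

Lemma sum_pairing_le_of_p_summing (C : R) :
  (forall n (m : 'I_n -> free X),
    strong_lp p (fun i => linearization T (m i)) <= C * weak_lp p m) ->
  forall n (m : 'I_n -> free X) (g : 'I_n -> lip0 Y R^o),
    \sum_i `|lin_pairing T (m i) (g i) : R| <= C * (weak_lp p m * strong_lp q g).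
Proof.
move=> TC n m g; rewrite mulrA.
apply: (le_trans (sum_normM_le_strong_lp _ _ p1)).
by apply: ler_wpM2r; [exact: lp_norm_ge0|exact: TC].
Qed.

Lemma p_summing_M_strictly :
  p_summing p (linearization T) -> M_strictly_lip_summing p T.
Proof.
move=> [C C0 TC]; exists C => // l x y g.
rewrite -ler_pdivrMl//; apply: lb_le_inf.
  exists (weak_lp p (fun k => delta (x k) (y k)) * strong_lp q g).
  by exists l, x, y, g, l, (fun k => delta (x k) (y k)), g; split.
move=> _ [l' [x' [y' [s' [n [m [e [us me ->]]]]]]]].
rewrite ler_pdivrMl//.
(* The infimum in [dL] also ranges over other delta representations of the same functional;
   separation of points of Y^# shows that they define the same tensor. *)
have sep := @dual_lip0_sep R Y.
have tE := lip_tensor_eq sep us.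
have := sum_lin_pairing_tensor (etrans me (esym tE)) => <-.
apply: le_trans (sum_pairing_le_of_p_summing TC _ _).
exact: ler_norm_sum.
Qed.

Lemma M_strictly_p_summing :
  M_strictly_lip_summing p T -> p_summing p (linearization T).
Proof.
move=> [C C0 TC]; apply: (p_summing_of_pairing C0) => n m g.
have span n' (c : 'I_n' -> {k : nat & ('I_k -> R * (X * X))%type})
    (e : 'I_n' -> lip0 Y R^o) :
    \sum_i (lin_pairing T (delta_comb (c i)) (e i) : R) <=
    C * (weak_lp p (fun i => delta_comb (c i)) * strong_lp q e).
  (* The double sum over [i] and over the terms of [c i] is enumerated as a single one, with the
     scalars moved onto the second factor. *)
  pose I : finType := {i : 'I_n' & 'I_(tag (c i))}.
  pose d (t : I) := tagged (c (tag t)) (tagged t).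
  pose x (k : 'I_#|I|) := (d (enum_val k)).2.1.
  pose y (k : 'I_#|I|) := (d (enum_val k)).2.2.
  pose s (k : 'I_#|I|) := (d (enum_val k)).1 *: e (tag (enum_val k)).
  have ts : \sum_i tensor (delta_comb (c i)) (e i) =
      \sum_k tensor (delta (x k) (y k)) (s k).
    apply/funext => B; rewrite !fct_sumE.
    rewrite -(big_enum_val (fun t : I => tensor (delta (d t).2.1 (d t).2.2)
      ((d t).1 *: e (tag t)) B)) /=.
    transitivity (\sum_(i < n') \sum_(j < tag (c i))
        B ((tagged (c i) j).1 *: delta (tagged (c i) j).2.1 (tagged (c i) j).2.2)
          (e i)).
      by apply: eq_bigr => i _; rewrite /tensor /delta_comb linear_sumlz.
    rewrite sig_big_dep; apply: eq_bigr => t _.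
    by rewrite /tensor linearZl_LR linearZr_LR.
  rewrite (sum_lin_pairing_tensor ts).
  apply: (le_trans (ler_norm _)); apply: (le_trans (TC _ x y s)).
  rewrite ler_pM2l//; apply: ge_inf.
    exists 0 => _ [l' [x' [y' [s' [n'' [m'' [e' [_ _ ->]]]]]]]].
    by rewrite mulr_ge0 ?weak_lp_ge0 ?lp_norm_ge0.
  by exists #|I|, x, y, s, n', (fun i => delta_comb (c i)), e.
(* Total error per unit of [e]: the weak norm grows by at most n e, and each pairing changes by at
   most e times the norms of the linearization and of [g i]. *)
pose W := C * (n%:R * strong_lp q g) + op_norm (linearization T) * \sum_i `|g i|.
have W0 : 0 <= W.
  by rewrite addr_ge0// ?mulr_ge0 ?op_norm_ge0 ?sumr_ge0 ?lp_norm_ge0// ltW.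
have W1 : 0 < W + 1 by rewrite ltr_wpDl.
apply/ler_addgt0Pr => eps eps0.
pose e := eps / (W + 1).
have e0 : 0 < e by rewrite divr_gt0.
have /choice[c mc] i := delta_comb_dense (m i) e0.
apply: (@le_trans _ _ (C * (weak_lp p m * strong_lp q g) + W * e)); last first.
  by rewrite lerD2l /e mulrCA ler_piMr ?(ltW eps0)// ler_pdivrMr// mul1r lerDl.
have wc : weak_lp p (fun i => delta_comb (c i)) <= weak_lp p m + n%:R * e.
  apply: (le_trans (weak_lp_perturb p1 _ m)); rewrite lerD2l.
  apply: (@le_trans _ _ (\sum_(i < n) e)).
    by apply: ler_sum => i _; rewrite distrC ltW.
  by rewrite sumr_const card_ord -[leLHS]mulr_natl.
have -> : \sum_i (lin_pairing T (m i) (g i) : R) =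
    \sum_i (lin_pairing T (delta_comb (c i)) (g i) : R) +
    \sum_i (lin_pairing T (m i - delta_comb (c i)) (g i) : R).
  by rewrite -big_split; apply: eq_bigr => i _; rewrite linearBl [RHS]addrC subrK.
have bnd i : lin_pairing T (m i - delta_comb (c i)) (g i) <=
    op_norm (linearization T) * `|g i| * e.
  apply: (le_trans (ler_norm _)); apply: (le_trans (op_normP _ _)).
  rewrite mulrAC; apply: ler_wpM2r => //.
  apply: (le_trans (op_normP (linearization T) (m i - delta_comb (c i)))).
  by rewrite ler_wpM2l ?op_norm_ge0 ?ltW.
apply: (le_trans (lerD (span _ c g) (ler_sum _ (fun i _ => bnd i)))).
rewrite -mulr_suml -mulr_sumr /W [(_ + _) * e]mulrDl addrA lerD2r.
rewrite -mulrA -mulrDr ler_pM2l// mulrAC -mulrDl.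
by rewrite ler_wpM2r ?lp_norm_ge0.
Qed.

Lemma cohen_p_summing :
  cohen_strongly_summing q (lip_adj T) -> p_summing p (linearization T).
Proof.
move=> [C C0 TC]; apply: (p_summing_of_pairing C0) => n m g.
have := TC n g (fun i => free_val (m i)); rewrite hoelder_conjugateK => h.
apply: (@le_trans _ _ (\sum_i `|lin_pairing T (m i) (g i) : R|)).
  by apply: ler_sum => i _; exact: ler_norm.
apply: (le_trans h); rewrite ler_pM2l// mulrC ler_wpM2r ?lp_norm_ge0//.
exact: weak_lp_free_val.
Qed.

Lemma p_summing_cohen :
  p_summing p (linearization T) -> cohen_strongly_summing q (lip_adj T).
Proof.
move=> [C C0 TC]; have TC' := sum_pairing_le_of_p_summing TC.
(* The factor 2 is the loss from the finite net. *)
exists (2 * C); first by rewrite mulr_gt0.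
move=> n g y; rewrite hoelder_conjugateK.
(* Signs are absorbed into [g], so that the sum of moduli becomes linear in the [g'] and the
   decomposition applies. *)
pose s i : R := sgr (y i (lip_adj T (g i)) : R).
pose g' i := s i *: g i.
have gg' : strong_lp q g' <= strong_lp q g.
  apply: ler_lp_norm => [|i]; first exact: hoelder_conj_ge1.
  rewrite !normr_id normrZ normr_sg.
  by case: (_ != _); rewrite ?mul1r// mul0r.
have yg i : `|y i (lip_adj T (g i)) : R| = y i (lip_adj T (g' i)).
  by rewrite normrEsg /g' !linearZ.
pose f i := eval_free (lip_adj T (g' i)).
have fC (m : 'I_n -> free X) :
    \sum_i (f i (m i) : R) <= C * strong_lp q g' * weak_lp p m.
  rewrite -mulrA [strong_lp _ _ * _]mulrC; apply: le_trans (TC' n m g').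
  by apply: ler_sum => i _; exact: ler_norm.
have [|K [b [h [b1 hN fE]]]] := weak_lp_functional p1 _ fC.
  by rewrite mulr_ge0 ?lp_norm_ge0// ltW.
(* Evaluating the decomposition of [f i] at the points [delta_pt x] transports it from F(X)^* to
   X^#, where each [y i] can act on it. *)
have gE i : lip_adj T (g' i) = \sum_k b k i *: lip0_of_dual (h k).
  apply: lip0_ext => x.
  have := congr1 (fun u : dual (free X) => u (delta_pt x)) (fE i).
  rewrite (big_morph (fun u : dual (free X) => u (delta_pt x)) (id1 := 0) (op1 := +%R))//.
  rewrite (big_morph (fun u : lip0 X R^o => u x) (id1 := 0) (op1 := +%R))// => <-.
  have -> : f i (delta_pt x) = lip_adj T (g' i) x - lip_adj T (g' i) point by [].
  by rewrite [lip_adj T (g' i) point]lip0_point subr0.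
under eq_bigr do rewrite yg gE.
(* After the exchange, each inner sum pairs a net vector [b k] with the values on [y] of one fixed
   functional, which the weak norm of [y] controls. *)
have -> : \sum_i (y i (\sum_k b k i *: lip0_of_dual (h k)) : R) =
    \sum_k \sum_i b k i * (bidual_eval (lip0_of_dual (h k)) (y i) : R).
  rewrite exchange_big; apply: eq_bigr => i _ /=.
  by rewrite linear_sum; apply: eq_bigr => k _; rewrite linearZ.
apply: (@le_trans _ _ (\sum_k op_norm (h k) * weak_lp p y)).
  apply: ler_sum => k _; apply: (le_trans (weak_lp_pairing p1 _ _ (b1 k))).
  rewrite ler_wpM2r ?weak_lp_ge0//.
  exact: le_trans (norm_bidual_eval _) (norm_lip0_of_dual _).
rewrite -mulr_suml mulrA ler_wpM2r ?weak_lp_ge0//.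
apply: (le_trans hN); by rewrite mulrA ler_wpM2l ?mulr_ge0 ?(ltW C0).
Qed.

End Equivalences.

Unset Implicit Arguments.

Theorem proposition2p4 (R : realType) (p : \bar R) (hp : (1 <= p)%E)
    (X Y : pmetricType R) (T : lipop X Y) :
  (M_strictly_lip_summing p T <-> p_summing p (linearization T)) /\
  (p_summing p (linearization T) <->
     cohen_strongly_summing (hoelder_conjugate p) (lip_adj T)).
Proof.
split; split.
- exact: M_strictly_p_summing.
- exact: p_summing_M_strictly.
- exact: p_summing_cohen.
- exact: cohen_p_summing.
Qed.
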